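(* Let $\mathcal F=\{F^\lambda\}_{\lambda\in\Lambda}$ be a family of affine iterated function systems on $\mathbb R^d$ satisfying the standing assumptions of the context, let $\Omega$ be the associated space of code trees with neck lists, and let $\Xi:\Omega\to\Omega$ be the shift. Assume that $P$ is an ergodic $\Xi$-invariant Borel probability measure on $\Omega$ with $\int_\Omega N_1(\omega)\,dP(\omega)<\infty$. Let $s_0$ be the $P$-almost surely constant unique zero of the pressure $p^\omega$. Then the affinity dimension satisfies $\alpha^\omega=s_0$ for $P$-almost all $\omega\in\Omega$.
   Context: Conventions: $\mathbb N=\{1,2,\dots\}$. Family of systems. $\Lambda$ is a topological space and for each $\lambda\in\Lambda$, $F^\lambda=\{f_i^\lambda=T_i^\lambda+a_i^\lambda\}_{i=1}^{M_\lambda}$ ($M_\lambda\ge1$) is an affine iterated function system on $\mathbb R^d$, with $T_i^\lambda:\mathbb R^d\to\mathbb R^d$ linear and non-singular and $a_i^\lambda\in\mathbb R^d$. Standing assumptions: $\sup_{\lambda,i}|a_i^\lambda|<\infty$; $M=\sup_\lambda M_\lambda<\infty$; there are $\underline\sigma,\overline\sigma\in(0,1)$ with $\underline\sigma\le\sigma_d(T_i^\lambda)\le\dots\le\sigma_1(T_i^\lambda)=\|T_i^\lambda\|\le\overline\sigma$ for all $\lambda\in\Lambda$, $1\le i\le M_\lambda$, where $\sigma_j(T)$ is the $j$-th singular value; the map $\lambda\mapsto F^\lambda\in\bigcup_{i=1}^M\mathbb R^{(d^2+d)i}$ (disjoint union) is Borel measurable. Singular value function. For $0\le s<d$, $\Phi^s(T)=\sigma_1(T)\cdots\sigma_{m-1}(T)\sigma_m(T)^{s-m+1}$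 where $m$ is the integer with $m-1\le s<m$; for $s\ge d$, $\Phi^s(T)=\sigma_1(T)\cdots\sigma_{d-1}(T)\sigma_d(T)^{s-d+1}$. Code trees. Let $I=\{1,\dots,M\}$, $I^0=\{\emptyset\}$. For $\tilde\omega:\bigcup_{k\ge0}I^k\to\Lambda$ let $\Sigma_*^{\tilde\omega}\subset\bigcup_{k\ge0}I^k$ be the unique set of words with: $\emptyset\in\Sigma_*^{\tilde\omega}$; if $i_1\cdots i_k\in\Sigma_*^{\tilde\omega}$ and $\tilde\omega(i_1\cdots i_k)=\lambda$ then $i_1\cdots i_kl\in\Sigma_*^{\tilde\omega}$ iff $l\le M_\lambda$; if $i_1\cdots i_k\notin\Sigma_*^{\tilde\omega}$ then $i_1\cdots i_kl\notin\Sigma_*^{\tilde\omega}$ for all $l$. The restriction of $\tilde\omega$ to $\Sigma_*^{\tilde\omega}$ is called a code tree (also denoted $\tilde\omega$); $\widetilde\Omega$ is the set of code trees. Let $\Sigma^{\tilde\omega}=\{\mathbf i=i_1i_2\cdots\in I^{\mathbb N}: i_1\cdots i_n\in\Sigma_*^{\tilde\omega}\ \forall n\}$. Write $\mathbf i_k$ for a word of length $k$, and $[\mathbf i_k]=\{\mathbf j\in\Sigma^{\tilde\omega}: j_l=i_l,\ l=1,\dots,k\}$ for the cylinder it determines. Set $T^{\tilde\omega}_{\mathbf i_k}=T_{i_1}^{\tilde\omega(\emptyset)}T_{i_2}^{\tilde\omega(i_1)}\cdots T_{i_k}^{\tilde\omega(i_1\cdots i_{k-1})}$. Neck lists. $\Omega$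 is the set of pairs $\omega=(\tilde\omega,\mathbf N)$ with $\tilde\omega\in\widetilde\Omega$ and $\mathbf N=(N_m)_{m\in\mathbb N}$ a strictly increasing sequence of natural numbers (a neck list) such that: if $\mathbf i_{N_m}\mathbf j_l,\ \mathbf i'_{N_m}\in\Sigma_*^{\tilde\omega}$ (words of lengths $N_m+l$ and $N_m$, $l\ge0$), then $\mathbf i'_{N_m}\mathbf j_l\in\Sigma_*^{\tilde\omega}$ and $\tilde\omega(\mathbf i_{N_m}\mathbf j_l)=\tilde\omega(\mathbf i'_{N_m}\mathbf j_l)$. Write $N_m(\omega)=N_m$, and $\Sigma^\omega_*,\Sigma^\omega,T^\omega$, etc. for the corresponding objects of $\tilde\omega$. The shift is $\Xi(\tilde\omega,\mathbf N)=(\hat\omega,\hat{\mathbf N})$ with $\hat N_m=N_{m+1}-N_1$ and $\hat\omega(\mathbf j_l)=\tilde\omega(\mathbf i_{N_1}\mathbf j_l)$ (independent of the choice of $\mathbf i_{N_1}\in\Sigma_*^{\tilde\omega}$). $\Omega$ carries the topology generated by the cylinders $\{(\hat\omega,\hat{\mathbf N})\in\Omega:\hat N_i=N_i\ \forall i\le m,\ \hat\omega(\tau)=\tilde\omega(\tau)\ \forall\,|\tau|<N_m\}$, and its Borel $\sigma$-algebra. Pressure. $p^\omega(s)=\lim_{k\to\infty}\frac1k\log\sum_{\mathbf i_k\in\Sigma_*^\omega}\Phi^s(T^\omega_{\mathbf i_k})$ when the limit exists (sum over all words of length $k$ in $\Sigma_*^\omega$). It is a known result that if $P$ is an ergodic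 $\Xi$-invariant Borel probability measure on $\Omega$ with $\int N_1\,dP<\infty$, then for $P$-almost all $\omega$ the pressure $p^\omega(s)$ exists for all $s\ge0$, $p^\omega$ is strictly decreasing, and there is a unique $s_0$ (not depending on $\omega$) with $p^\omega(s_0)=0$ for $P$-almost all $\omega$. Affinity dimension. For $s\ge0$ and Borel $E\subset\Sigma^\omega$ let $\mathcal M^s(E)=\lim_{j\to\infty}\mathcal M^s_j(E)$, where $\mathcal M^s_j(E)=\inf\{\sum_{\mathbf i\in J}\Phi^s(T^\omega_{\mathbf i}): J\subset\Sigma_*^\omega,\ E\subset\bigcup_{\mathbf i\in J}[\mathbf i],\ \text{every word in }J\text{ has length}\ge j\}$. The affinity dimension is $\alpha^\omega=\inf\{s\ge0:\mathcal M^s(\Sigma^\omega)=0\}=\sup\{s\ge0:\mathcal M^s(\Sigma^\omega)=\infty\}$ (with $\sup\emptyset=0$). *)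

(* Defs.v *)
From HB Require Import structures.
From mathcomp Require Import all_boot all_order all_algebra.
From mathcomp Require Import all_classical all_reals all_analysis.
Set Implicit Arguments.
Unset Strict Implicit.
Unset Printing Implicit Defensive.
Import Order.TTheory GRing.Theory Num.Theory.
Import numFieldNormedType.Exports.
Local Open Scope classical_set_scope.
Local Open Scope ring_scope.

(* The square roots of the eigenvalues of A^T A, listed with multiplicity in
   nonincreasing order; the factorization forces [size s = d]. *)
Definition is_singular_values (R : realType) (d : nat) (A : 'M[R]_d)
    (s : seq R) : Prop :=
  [/\ sorted >=%R s, all (fun x => 0 <= x) s &
      char_poly (A^T *m A) = \prod_(x <- s) ('X - (x ^+ 2)%:P)].

Definition singular_values (R : realType) (d : nat) (A : 'M[R]_d) : seq R :=
  xget [::] [set s | is_singular_values A s].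

(* Indexed from 0: [sigma A j] is the (j+1)-st singular value. *)
Definition sigma (R : realType) (d : nat) (A : 'M[R]_d) (j : nat) : R :=
  nth 0 (singular_values A) j.

(* [k] is m - 1 in the usual notation, that is, the integer part of s. *)
Definition Phi (R : realType) (d : nat) (s : R) (A : 'M[R]_d) : R :=
  if s < d%:R then
    let k := Num.truncn s in
    (\prod_(j < k) sigma A j) * sigma A k `^ (s - k%:R)
  else
    (\prod_(j < d.-1) sigma A j) * sigma A d.-1 `^ (s - d%:R + 1).

(* The map x |-> T x + a is the pair (T, a). The type carries the topology of
   the disjoint union over n of the spaces (R^(d^2+d))^n. *)
Definition affineIFS (R : realType) (d : nat) : topologicalType :=
  {n : nat & prod_topology (fun _ : 'I_n => ('M[R]_d * 'cV[R]_d)%type)}.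

Definition nmaps (R : realType) (d : nat) (G : affineIFS R d) : nat := projT1 G.

Definition linear_part (R : realType) (d : nat) (G : affineIFS R d)
  (i : 'I_(nmaps G)) : 'M[R]_d := (projT2 G i).1.

Definition translation (R : realType) (d : nat) (G : affineIFS R d)
  (i : 'I_(nmaps G)) : 'cV[R]_d := (projT2 G i).2.

Definition euclidean_norm (R : realType) (d : nat) (v : 'cV[R]_d) : R :=
  Num.sqrt (\sum_(k < d) v k 0 ^+ 2).

Record affineFamily (R : realType) (d : nat) (L : topologicalType) := AffineFamily {
  ifs :> L -> affineIFS R d;
  maxmaps : nat;
  nmaps_gt0 : forall l, (0 < nmaps (ifs l))%N;
  (* [maxmaps] is the supremum of the numbers of maps: a finite supremum of
     natural numbers is attained. In particular L is nonempty. *)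
  nmaps_le : forall l, (nmaps (ifs l) <= maxmaps)%N;
  nmaps_sup : exists l, nmaps (ifs l) = maxmaps;
  linear_part_unit : forall l i, linear_part (G := ifs l) i \in unitmx;
  translation_bounded : exists C : R,
    forall l i, euclidean_norm (translation (G := ifs l) i) <= C;
  sigma_bounded : exists lo hi : R, [/\ 0 < lo, lo < 1, 0 < hi, hi < 1 &
    forall l i j, (j < d)%N -> lo <= sigma (linear_part (G := ifs l) i) j <= hi];
  ifs_borel : forall B : set (affineIFS R d),
    <<s open >> B -> <<s open >> (ifs @^-1` B)
}.

(* The alphabet {1, ..., M} is 'I_M, the letter i standing for i + 1, and words
   are sequences. A code tree is a partial function on words, its domain being
   Sigma_*: [tree w u] is [None] exactly when u is not in Sigma_*. The positions
   in a neck list are numbered from 0: [neck w m] is N_(m+1). *)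
Record codeTree (R : realType) (d : nat) (L : topologicalType)
    (F : affineFamily R d L) := CodeTree {
  tree : seq 'I_(maxmaps F) -> option L;
  neck : nat -> nat;
  tree_root : isSome (tree [::]);
  tree_step : forall u (i : 'I_(maxmaps F)),
    isSome (tree (rcons u i)) = if tree u is Some l then (i < nmaps (F l))%N
                                else false;
  neck_gt0 : (0 < neck 0)%N;
  neck_incr : forall m, (neck m < neck m.+1)%N;
  neckP : forall m u u' v, size u = neck m -> size u' = neck m ->
    isSome (tree (u ++ v)) -> isSome (tree u') ->
    isSome (tree (u' ++ v)) /\ tree (u ++ v) = tree (u' ++ v)
}.

Lemma codeTree_eq (R : realType) (d : nat) (L : topologicalType)
  (F : affineFamily R d L) (w w' : codeTree F) :
  tree w = tree w' -> neck w = neck w' -> w = w'.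
Proof.
case: w => t n p1 p2 p3 p4 p5; case: w' => t' n' q1 q2 q3 q4 q5 /= et en.
subst t' n'; congr CodeTree; exact: Prop_irrelevance.
Qed.

Lemma tree_prefix (R : realType) (d : nat) (L : topologicalType)
  (F : affineFamily R d L) (w : codeTree F) u v :
  isSome (tree w (u ++ v)) -> isSome (tree w u).
Proof.
elim/last_ind: v => [|v i ih]; first by rewrite cats0.
by rewrite -rcons_cat tree_step; case: (tree w (u ++ v)) ih => // l ih _; exact: ih.
Qed.

Lemma tree_word (R : realType) (d : nat) (L : topologicalType)
  (F : affineFamily R d L) (w : codeTree F) n :
  exists u, size u = n /\ isSome (tree w u).
Proof.
elim: n => [|n [u [su wu]]]; first by exists [::]; split => //; exact: tree_root.
case E: (tree w u) wu => [l|] // _.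
have M0 : (0 < maxmaps F)%N := leq_trans (nmaps_gt0 F l) (nmaps_le F l).
exists (rcons u (Ordinal M0)); split; first by rewrite size_rcons su.
by rewrite tree_step E; exact: nmaps_gt0.
Qed.

(* The choice of the word is immaterial, see [shift_treeE]. *)
Definition neck_word (R : realType) (d : nat) (L : topologicalType)
    (F : affineFamily R d L) (w : codeTree F) : seq 'I_(maxmaps F) :=
  xget [::] [set u | size u = neck w 0 /\ isSome (tree w u)].

Lemma neck_wordP (R : realType) (d : nat) (L : topologicalType)
  (F : affineFamily R d L) (w : codeTree F) :
  size (neck_word w) = neck w 0 /\ isSome (tree w (neck_word w)).
Proof.
have [u wu] := tree_word w (neck w 0).
exact: (@xgetPex _ [::] [set u | size u = neck w 0 /\ isSome (tree w u)]
  (ex_intro _ u wu)).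
Qed.

Definition shift_tree (R : realType) (d : nat) (L : topologicalType)
    (F : affineFamily R d L) (w : codeTree F) : seq 'I_(maxmaps F) -> option L :=
  fun v => tree w (neck_word w ++ v).

Definition shift_neck (R : realType) (d : nat) (L : topologicalType)
    (F : affineFamily R d L) (w : codeTree F) : nat -> nat :=
  fun m => (neck w m.+1 - neck w 0)%N.

Lemma neck_le0 (R : realType) (d : nat) (L : topologicalType)
  (F : affineFamily R d L) (w : codeTree F) m : (neck w 0 <= neck w m)%N.
Proof. by elim: m => // m /leq_trans; apply; exact/ltnW/neck_incr. Qed.

Lemma shift_root (R : realType) (d : nat) (L : topologicalType)
  (F : affineFamily R d L) (w : codeTree F) : isSome (shift_tree w [::]).
Proof. by rewrite /shift_tree cats0; case: (neck_wordP w). Qed.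

Lemma shift_step (R : realType) (d : nat) (L : topologicalType)
  (F : affineFamily R d L) (w : codeTree F) u (i : 'I_(maxmaps F)) :
  isSome (shift_tree w (rcons u i)) =
  if shift_tree w u is Some l then (i < nmaps (F l))%N else false.
Proof. by rewrite /shift_tree -rcons_cat tree_step. Qed.

Lemma shift_neck_gt0 (R : realType) (d : nat) (L : topologicalType)
  (F : affineFamily R d L) (w : codeTree F) : (0 < shift_neck w 0)%N.
Proof. by rewrite subn_gt0 neck_incr. Qed.

Lemma shift_neck_incr (R : realType) (d : nat) (L : topologicalType)
  (F : affineFamily R d L) (w : codeTree F) m :
  (shift_neck w m < shift_neck w m.+1)%N.
Proof. by apply: ltn_sub2r; [exact: leq_ltn_trans (neck_le0 _ _) (neck_incr _ _)
  |exact: neck_incr]. Qed.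

Lemma shift_neckP (R : realType) (d : nat) (L : topologicalType)
  (F : affineFamily R d L) (w : codeTree F) m u u' v :
  size u = shift_neck w m -> size u' = shift_neck w m ->
  isSome (shift_tree w (u ++ v)) -> isSome (shift_tree w u') ->
  isSome (shift_tree w (u' ++ v)) /\ shift_tree w (u ++ v) = shift_tree w (u' ++ v).
Proof.
have [sw _] := neck_wordP w.
rewrite /shift_tree !catA => su su'; apply: (@neckP _ _ _ _ w m.+1).
- by rewrite size_cat sw su subnKC// neck_le0.
- by rewrite size_cat sw su' subnKC// neck_le0.
Qed.

Definition Xi (R : realType) (d : nat) (L : topologicalType)
    (F : affineFamily R d L) (w : codeTree F) : codeTree F :=
  CodeTree (shift_root w) (shift_step w) (shift_neck_gt0 w)
    (shift_neck_incr w) (@shift_neckP _ _ _ _ w).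

Lemma shift_treeE (R : realType) (d : nat) (L : topologicalType)
  (F : affineFamily R d L) (w : codeTree F) u v :
  size u = neck w 0 -> isSome (tree w u) -> tree (Xi w) v = tree w (u ++ v).
Proof.
move=> su wu; have [sw ww] := neck_wordP w; rewrite /= /shift_tree.
have [wv|nwv] := boolP (isSome (tree w (neck_word w ++ v))).
  by have [] := neckP sw su wv wu.
have [wv|] := boolP (isSome (tree w (u ++ v))).
  by have [h] := neckP su sw wv ww; rewrite h in nwv.
by case: (tree w (u ++ v)) => //; case: (tree w _) nwv.
Qed.

HB.instance Definition _ (R : realType) (d : nat) (L : topologicalType)
  (F : affineFamily R d L) := gen_eqMixin (codeTree F).
HB.instance Definition _ (R : realType) (d : nat) (L : topologicalType)
  (F : affineFamily R d L) := gen_choiceMixin (codeTree F).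

(* The constant code tree with every level a neck, needed only because
   measurable types have to be inhabited. *)
Section constant_tree.
Context (R : realType) (d : nat) (L : topologicalType) (F : affineFamily R d L).

Let l0 : L := projT1 (cid (nmaps_sup F)).
Let ctree (u : seq 'I_(maxmaps F)) : option L :=
  if all (fun i : 'I_(maxmaps F) => i < nmaps (F l0))%N u then Some l0 else None.

Let ctree_step u (i : 'I_(maxmaps F)) :
  isSome (ctree (rcons u i)) = if ctree u is Some l then (i < nmaps (F l))%N
                                else false.
Proof. by rewrite /ctree all_rcons; case: all; rewrite ?andbT ?andbF//; case: ifP. Qed.

Let ctree_neckP m u u' v : size u = m.+1 -> size u' = m.+1 ->
  isSome (ctree (u ++ v)) -> isSome (ctree u') ->
  isSome (ctree (u' ++ v)) /\ ctree (u ++ v) = ctree (u' ++ v).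
Proof. by move=> _ _; rewrite /ctree !all_cat; do 3!case: all. Qed.

Definition constant_tree : codeTree F :=
  @CodeTree _ _ _ F ctree succn isT ctree_step isT (fun m => ltnSn m.+1)
    ctree_neckP.

End constant_tree.

HB.instance Definition _ (R : realType) (d : nat) (L : topologicalType)
  (F : affineFamily R d L) := isPointed.Build (codeTree F) (constant_tree F).

Definition tree_cylinder (R : realType) (d : nat) (L : topologicalType)
    (F : affineFamily R d L) (wm : codeTree F * nat) : set (codeTree F) :=
  [set w | (forall i, (i <= wm.2)%N -> neck w i = neck wm.1 i) /\
           (forall u, (size u < neck wm.1 wm.2)%N -> tree w u = tree wm.1 u)].

HB.instance Definition _ (R : realType) (d : nat) (L : topologicalType)
  (F : affineFamily R d L) :=
  @isSubBaseTopological.Build (codeTree F) (codeTree F * nat)%type setT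
    (@tree_cylinder R d L F).

Definition borelCodeTree (R : realType) (d : nat) (L : topologicalType)
  (F : affineFamily R d L) := g_sigma_algebraType (@open (codeTree F)).

Definition invariant_measure (R : realType) (d : nat) (L : topologicalType)
    (F : affineFamily R d L) (P : probability (borelCodeTree F) R) : Prop :=
  forall B : set (borelCodeTree F), measurable B -> P (@Xi R d L F @^-1` B) = P B.

Definition ergodic_measure (R : realType) (d : nat) (L : topologicalType)
    (F : affineFamily R d L) (P : probability (borelCodeTree F) R) : Prop :=
  forall B : set (borelCodeTree F), measurable B -> @Xi R d L F @^-1` B = B ->
    P B = 0%E \/ P B = 1%E.

(* The default value [1%:M] is never used along words of the code tree. *)
Definition letter_map (R : realType) (d : nat) (L : topologicalType)
    (F : affineFamily R d L) (ol : option L) (i : nat) : 'M[R]_d :=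
  if ol is Some l then
    if insub i is Some j then linear_part (G := F l) j else 1%:M
  else 1%:M.

Fixpoint word_map (R : realType) (d : nat) (L : topologicalType)
    (F : affineFamily R d L) (t : seq 'I_(maxmaps F) -> option L)
    (u : seq 'I_(maxmaps F)) : 'M[R]_d :=
  if u is i :: v then
    letter_map F (t [::]) i *m word_map (fun x => t (i :: x)) v
  else 1%:M.

(* Since [0%:R^-1 = 0], the value at k = 0 is irrelevant. *)
Definition pressure_seq (R : realType) (d : nat) (L : topologicalType)
    (F : affineFamily R d L) (w : codeTree F) (s : R) (k : nat) : R :=
  k%:R^-1 * ln (\sum_(u : k.-tuple 'I_(maxmaps F) | isSome (tree w u))
                  Phi s (word_map (tree w) u)).

Definition has_pressure (R : realType) (d : nat) (L : topologicalType)
    (F : affineFamily R d L) (w : codeTree F) (s p : R) : Prop :=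
  pressure_seq w s @ \oo --> p.

(* The length-n initial word of an infinite word is [mkseq x n]. *)
Definition boundary (R : realType) (d : nat) (L : topologicalType)
    (F : affineFamily R d L) (w : codeTree F) : set (nat -> 'I_(maxmaps F)) :=
  [set x | forall n, isSome (tree w (mkseq x n))].

Definition word_cylinder (R : realType) (d : nat) (L : topologicalType)
    (F : affineFamily R d L) (w : codeTree F) (u : seq 'I_(maxmaps F)) :
    set (nat -> 'I_(maxmaps F)) :=
  [set x | boundary w x /\ mkseq x (size u) = u].

Definition affinity_premeasure (R : realType) (d : nat) (L : topologicalType)
    (F : affineFamily R d L) (w : codeTree F) (s : R) (j : nat)
    (E : set (nat -> 'I_(maxmaps F))) : \bar R :=
  ereal_inf [set (\esum_(u in J) (Phi s (word_map (tree w) u))%:E)%E |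
    J in [set J : set (seq 'I_(maxmaps F)) |
      [/\ forall u, J u -> isSome (tree w u),
          E `<=` \bigcup_(u in J) word_cylinder w u &
          forall u, J u -> (j <= size u)%N]]].

Definition affinity_measure (R : realType) (d : nat) (L : topologicalType)
    (F : affineFamily R d L) (w : codeTree F) (s : R)
    (E : set (nat -> 'I_(maxmaps F))) : \bar R :=
  limn (fun j => affinity_premeasure w s j E).

Definition affinity_dimension (R : realType) (d : nat) (L : topologicalType)
    (F : affineFamily R d L) (w : codeTree F) : \bar R :=
  ereal_inf [set s%:E | s in
    [set s : R | 0 <= s /\ affinity_measure w s (boundary w) = 0%E]].

(* Main.v *)
Require Import Defs.
From mathcomp Require Import all_boot all_order all_algebra all_fingroup.
From mathcomp Require Import all_classical all_reals all_analysis.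
From mathcomp Require Import measurable_realfun finmap complex ring lra zify.
Set Implicit Arguments.
Unset Strict Implicit.
Unset Printing Implicit Defensive.
Import Order.TTheory GRing.Theory Num.Theory.
Import numFieldNormedType.Exports.
Local Open Scope classical_set_scope.
Local Open Scope ring_scope.
Local Open Scope sesquilinear_scope.

(** The inequality [affinity_dimension w <= s0] is elementary: the sum of
    [Phi s] over the words of length n decays exponentially once s > s0.

    For the converse fix s < s0. Words cut at the necks concatenate
    independently, so for a submultiplicative weight psi the sum S_n of psi over
    the words of length N_n satisfies S_n(w) <= S_(n-m)(Xi^m w) for some
    0 < m <= l whenever w has a cover by words of at most l neck levels with
    weight less than 1; in any case S_n(w) <= M^(N_1) S_(n-1)(Xi w). Let Z be the
    set of code trees with such covers of arbitrarily small weight. Iterating,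
    on Z the number log S_n is at most log M times the total length of the last l
    neck gaps and of those with no cover of at most l levels; Z is forward invariant, so
    integrating and letting l tend to infinity gives a mean growth o(n). But
    log S_n >= c n for large n, with c > 0, since the pressure at s is positive.
    Hence P(Z) = 0. Finally the gaps between necks are almost surely sublinear,
    so that extending the words of a cover to the next neck costs only a
    subexponential factor, and M^(s') (Sigma) = 0 with s' < s forces w into Z.

    For s < d the weight psi is the singular value function itself; it is
    submultiplicative since by Cauchy-Binet the product of the k largest singular
    values is. For s >= d the function [Phi s] is |det| times a power of the
    smallest singular value, which is supermultiplicative; then psi is the product
    of [Phi s] over blocks of K successive neck gaps, whose growth is close to that
    of [Phi s] when K is large. *)

(** * Cauchy-Binet *)

(** Each row of [P *m Q] is a combination of rows of [Q]; multilinearity expands the determinant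
    over the choice [f i] of a summand in every row. *)
Lemma det_mulmx_rowsub (K : comNzRingType) (k d : nat) (P : 'M[K]_(k, d)) (Q : 'M[K]_(d, k)) :
  \det (P *m Q) =
  \sum_(f : {ffun 'I_k -> 'I_d}) (\prod_i P i (f i)) * \det (rowsub f Q).
Proof.
rewrite /determinant; under eq_bigr => s _.
  under eq_bigr => i _ do rewrite mxE.
  rewrite bigA_distr_bigA /= mulr_sumr; over.
rewrite exchange_big /=; apply: eq_bigr => f _.
rewrite mulr_sumr; apply: eq_bigr => s _.
rewrite big_split /= mulrCA; congr (_ * (_ * _)).
by apply: eq_bigr => i _; rewrite !mxE.
Qed.

(* The Cauchy-Binet formula, every set of indices being counted k! times. *)
Lemma cauchy_binet (K : comNzRingType) (k d : nat) (P : 'M[K]_(k, d)) (Q : 'M[K]_(d, k)) :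
  (k`!)%:R * \det (P *m Q) =
  \sum_(f : {ffun 'I_k -> 'I_d}) \det (colsub f P) * \det (rowsub f Q).
Proof.
transitivity (\sum_(s : 'S_k) \det (P *m Q)).
  by rewrite sumr_const card_Sn mulr_natl.
(* In the copy indexed by [s], replacing [f] by [f \o s] permutes the rows of [rowsub f Q] and
   yields the sign of [s]. Summing over [s] then recovers the determinant of [colsub f P]. *)
transitivity (\sum_(s : 'S_k) \sum_(f : {ffun 'I_k -> 'I_d})
   (\prod_i P i (f (s i))) * (-1) ^+ s * \det (rowsub f Q)).
  apply: eq_bigr => s _; rewrite det_mulmx_rowsub.
  pose h (t : 'S_k) (f : {ffun 'I_k -> 'I_d}) := [ffun i => f (t i)].
  rewrite (reindex_onto (h s) (h (s^-1)%g)) /=; last first.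
    by move=> f _; apply/ffunP => i; rewrite !ffunE permK.
  apply: eq_big => f.
    by apply/eqP/ffunP => i; rewrite !ffunE permKV.
  move=> _; rewrite -mulrA; congr (_ * _).
    by apply: eq_bigr => i _; rewrite ffunE.
  rewrite -[X in _ = X * _]det_perm -det_mulmx; congr (\det _).
  rewrite -row_permE; apply/matrixP => i j; by rewrite !mxE ffunE.
rewrite exchange_big /=; apply: eq_bigr => f _; rewrite -mulr_suml; congr (_ * _).
by rewrite /determinant; apply: eq_bigr => s _; rewrite mulrC; congr (_ * _);
  apply: eq_bigr => i _; rewrite !mxE.
Qed.

Lemma det_rowsub_not_injective (K : comNzRingType) (k d : nat) (f : 'I_k -> 'I_d)
  (Q : 'M[K]_(d, k)) : ~~ injectiveb f -> \det (rowsub f Q) = 0.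
Proof.
move/injectivePn => [i [j nij fij]].
by apply: (determinant_alternate nij) => l; rewrite !mxE fij.
Qed.

(** * Gram determinants of diagonal Hermitian forms *)

Section diagonal_forms.
Context (C : numClosedFieldType) (k d : nat).
Implicit Types (D : 'rV[C]_d) (Z : 'M[C]_(d, k)).

(** In the Cauchy-Binet expansion a repeated index gives two equal rows. For distinct indices the
    two minors are conjugate up to the diagonal entries, whence the squared modulus. *)
Lemma det_form_diag D Z :
  (k`!)%:R * \det (Z^t* *m diag_mx D *m Z) =
  \sum_(f : {ffun 'I_k -> 'I_d} | injectiveb f)
     (\prod_i D 0 (f i)) * `|\det (rowsub f Z)| ^+ 2.
Proof.
rewrite cauchy_binet big_mkcond [RHS]big_mkcond; apply: eq_bigr => f _.
case: ifPn => [_|/det_rowsub_not_injective ->]; last by rewrite mulr0.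
have -> : colsub f (Z^t* *m diag_mx D) = (rowsub f Z)^t* *m diag_mx (\row_i D 0 (f i)).
  by apply/matrixP => i j; rewrite !mul_mx_diag !mxE.
rewrite det_mulmx det_diag det_map_mx det_tr normCKC mulrCA mulrA.
by under eq_bigr do rewrite mxE.
Qed.

(** The expansions for [D] and for the identity carry the same nonnegative minors, so they are
    compared term by term. *)
Lemma det_form_diag_le D Z (b : C) :
  (forall f : {ffun 'I_k -> 'I_d}, injectiveb f -> \prod_i D 0 (f i) <= b) ->
  \det (Z^t* *m diag_mx D *m Z) <= b * \det (Z^t* *m Z).
Proof.
move=> Db.
have kp : 0 < (k`!)%:R :> C by rewrite ltr0n fact_gt0.
rewrite -(ler_pM2l kp) mulrCA det_form_diag.
have := det_form_diag (const_mx 1) Z; rewrite diag_const_mx mulmx1 => ->.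
rewrite mulr_sumr; apply: ler_sum => f fi.
rewrite [X in _ <= b * (X * _)]big1 ?mul1r; last by move=> i _; rewrite mxE.
by apply: ler_wpM2r; [rewrite exprn_ge0| exact: Db].
Qed.

Lemma det_form_diag_ge D Z (b : C) :
  (forall f : {ffun 'I_k -> 'I_d}, injectiveb f -> b <= \prod_i D 0 (f i)) ->
  b * \det (Z^t* *m Z) <= \det (Z^t* *m diag_mx D *m Z).
Proof.
move=> Db.
have kp : 0 < (k`!)%:R :> C by rewrite ltr0n fact_gt0.
rewrite -(ler_pM2l kp) mulrCA det_form_diag.
have := det_form_diag (const_mx 1) Z; rewrite diag_const_mx mulmx1 => ->.
rewrite mulr_sumr; apply: ler_sum => f fi.
rewrite [X in b * (X * _) <= _]big1 ?mul1r; last by move=> i _; rewrite mxE.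
by apply: ler_wpM2r; [rewrite exprn_ge0| exact: Db].
Qed.

End diagonal_forms.

(** After sorting, the i-th entry of a list of distinct naturals is at least i. *)
Lemma prod_antitone_le (R : numDomainType) (g : nat -> R) (s : seq nat) :
  (forall i, 0 <= g i) -> (forall i j, (i <= j)%N -> g j <= g i) -> uniq s ->
  \prod_(x <- s) g x <= \prod_(i < size s) g i.
Proof.
move=> g0 ga us.
have ss : sorted ltn (sort leq s).
  by rewrite ltn_sorted_uniq_leq sort_uniq us sort_sorted// => x y; exact: leq_total.
rewrite -(perm_big _ (permEl (perm_sort leq s)))/=.
rewrite -(size_sort leq s); move: (sort leq s) ss => {us}t st.
rewrite (big_nth 0%N) big_mkord; apply: ler_prod => i _; rewrite g0 ga//.
have : (i < size t)%N := ltn_ord i; case: i => i /= _.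
elim: i => // i ih it; apply: (leq_ltn_trans (ih (ltnW it))).
by rewrite (sorted_ltn_nth ltn_trans 0%N st)// inE// ltnW.
Qed.

(** * Singular values *)

Lemma gram_unitary (C : numClosedFieldType) (d k : nat) (P : 'M[C]_d)
  (X : 'M[C]_(d, k)) : P \is unitarymx -> (P *m X)^t* *m (P *m X) = X^t* *m X.
Proof.
move=> Pu; rewrite trmx_mul map_mxM -mulmxA [P^t* *m _]mulmxA.
by rewrite -[P^t*]invmx_unitary// mulVmx ?unitarymx_unit// mul1mx.
Qed.

Lemma perm_mx_unitary (C : numClosedFieldType) (d : nat) (p : 'S_d) :
  perm_mx p \is @unitarymx C d d.
Proof.
apply/unitarymxP.
have -> : (perm_mx p)^t* = perm_mx (p^-1)%g :> 'M[C]_d.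
  by rewrite tr_perm_mx; apply/matrixP => i j; rewrite !mxE conjC_nat.
by rewrite -perm_mxM mulgV perm_mx1.
Qed.

Lemma row_perm_unitary (C : numClosedFieldType) (d : nat) (p : 'S_d)
  (P : 'M[C]_d) : P \is unitarymx -> row_perm p P \is unitarymx.
Proof. by move=> Pu; rewrite row_permE mul_unitarymx// perm_mx_unitary. Qed.

Lemma char_poly_unitary_diag (C : numClosedFieldType) (d : nat) (P : 'M[C]_d)
  (D : 'rV[C]_d) : P \is unitarymx ->
  char_poly (P^t* *m diag_mx D *m P) = \prod_j ('X - (D 0 j)%:P).
Proof.
move=> Pu; have PP : P^t* *m P = 1%:M.
  by rewrite -invmx_unitary// mulVmx// unitarymx_unit.
have <- : char_poly (diag_mx D) = \prod_j ('X - (D 0 j)%:P).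
  rewrite (char_poly_trig (diag_mx_is_trig D)).
  by apply: eq_bigr => j _; rewrite mxE eqxx mulr1n.
have PP' : map_mx polyC (P^t*) *m map_mx polyC P = 1%:M.
  by rewrite -map_mxM PP map_mx1.
rewrite /char_poly.
have -> : char_poly_mx (P^t* *m diag_mx D *m P) =
    map_mx polyC (P^t*) *m char_poly_mx (diag_mx D) *m map_mx polyC P.
  rewrite /char_poly_mx mulmxBr mulmxBl -!map_mxM; congr (_ - _).
  by rewrite mul_mx_scalar -scalemxAl PP' scalemx1.
by rewrite !det_mulmx mulrAC -det_mulmx PP' det1 mul1r.
Qed.

Section singular_values.
Context (R : realType) (d : nat).
Local Notation C := R[i].
Local Notation cx := (real_complex R).
Implicit Types A B : 'M[R]_d.

Local Notation toC := (map_mx cx).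

Lemma conj_real_complex (x : R) : Num.conj (cx x) = cx x.
Proof. by apply/CrealP/complex_realP; exists x. Qed.

Lemma toC_conj m n (A : 'M[R]_(m, n)) : (toC A)^t* = toC (A^T).
Proof. by apply/matrixP => i j; rewrite !mxE conj_real_complex. Qed.

(** The Gram matrix is Hermitian, hence normal, and the complex spectral theorem applies. Its
    eigenvalues are squared norms of the columns of [toC A *m P^t*], hence real and nonnegative. *)
Lemma gram_spectral A : exists (P : 'M[C]_d) (e : 'rV[R]_d),
  [/\ P \is unitarymx, forall j, 0 <= e 0 j &
      (toC A)^t* *m toC A = P^t* *m diag_mx (map_mx cx e) *m P].
Proof.
set H := (toC A)^t* *m toC A.
have Hn : H \is normalmx.
  by apply/normalmxP; rewrite trmx_mul map_mxM trmxCK.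
have Pu := spectral_unitarymx H.
have /orthomx_spectralP := Hn.
set P := spectralmx H in Pu *; set D := spectral_diag H => HE.
rewrite invmx_unitary// in HE.
have D0 j : 0 <= D 0 j.
  have : (P *m H *m P^t*) j j = D 0 j.
    rewrite HE !mulmxA (unitarymxP Pu) mul1mx -mulmxA (unitarymxP Pu) mulmx1.
    by rewrite mxE eqxx.
  move=> <-; rewrite /H !mulmxA.
  have -> : P *m (toC A)^t* *m toC A *m P^t* = (toC A *m P^t*)^t* *m (toC A *m P^t*).
    by rewrite trmx_mul map_mxM trmxCK !mulmxA.
  by rewrite mxE; apply: sumr_ge0 => i _; rewrite !mxE -normCKC exprn_ge0.
pose e : 'rV[R]_d := \row_j complex.Re (D 0 j).
have eD : map_mx cx e = D.
  apply/rowP => j; rewrite !mxE; apply: RRe_real; exact: ger0_real.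
exists P, e; split => //; last by rewrite eD.
by move=> j; have := D0 j; rewrite -eD mxE ler0c.
Qed.

(** Sorting the square roots of the eigenvalues shows that the choice in [singular_values] is not
    the default; unique factorization of the characteristic polynomial identifies the squares with
    the eigenvalues up to order. *)
Lemma singular_values_spec A (e : 'rV[R]_d) (P : 'M[C]_d) :
  P \is unitarymx -> (forall j, 0 <= e 0 j) ->
  (toC A)^t* *m toC A = P^t* *m diag_mx (map_mx cx e) *m P ->
  is_singular_values A (singular_values A) /\
  perm_eq [seq x ^+ 2 | x <- singular_values A] [seq e 0 j | j <- enum 'I_d].
Proof.
move=> Pu e0 HE.
have cp : char_poly (A^T *m A) = \prod_j ('X - (e 0 j)%:P).
  apply: (map_poly_inj (GRing.RMorphism.clone _ _ cx _)); rewrite rmorph_prod.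
  rewrite map_char_poly map_mxM -toC_conj HE char_poly_unitary_diag//.
  by apply: eq_bigr => j _; rewrite rmorphB /= map_polyX map_polyC /= mxE.
have ex : exists s, is_singular_values A s.
  exists (sort >=%R [seq Num.sqrt (e 0 j) | j <- enum 'I_d]); split.
  - by apply: sort_sorted => x y; rewrite orbC; exact: le_total.
  - by rewrite all_sort; apply/allP => _ /mapP[j _ ->]; exact: sqrtr_ge0.
  - rewrite (perm_big _ (permEl (perm_sort _ _)))/= big_map cp big_enum/=.
    by apply: eq_bigr => j _; rewrite sqr_sqrtr.
have sv : is_singular_values A (singular_values A).
  exact: (@xgetPex _ [::] [set s | is_singular_values A s]).
split => //; apply: prod_XsubC_eq; rewrite big_map [RHS]big_map big_enum/= -cp.
by case: sv => _ _ ->.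
Qed.

Lemma singular_valuesP A : is_singular_values A (singular_values A).
Proof.
have [P [e [Pu e0 HE]]] := gram_spectral A.
by have [] := singular_values_spec Pu e0 HE.
Qed.

Lemma size_singular_values A : size (singular_values A) = d.
Proof.
have [P [e [Pu e0 HE]]] := gram_spectral A.
have [_ /perm_size] := singular_values_spec Pu e0 HE.
by rewrite size_map => ->; rewrite size_map size_enum_ord.
Qed.

Lemma sigma_ge0 A j : 0 <= sigma A j.
Proof.
rewrite /sigma; have [js|js] := ltnP j (size (singular_values A)); last by rewrite nth_default.
by have [_ /allP h _] := singular_valuesP A; apply: h; exact: mem_nth.
Qed.

Lemma sigma_antitone A i j : (i <= j)%N -> sigma A j <= sigma A i.
Proof.
move=> ij; have [js|js] := ltnP j (size (singular_values A)); last first.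
  by rewrite [leLHS]nth_default// sigma_ge0.
have [h _ _] := singular_valuesP A.
have tr : transitive (>=%R : rel R) by move=> x y z xy yz; exact: le_trans yz xy.
have rf : reflexive (>=%R : rel R) by move=> x /=.
by apply: (sorted_leq_nth tr rf 0 h) => //; rewrite inE// (leq_ltn_trans ij).
Qed.

(** Permuting the rows of the diagonalizing matrix brings the eigenvalues into the order of the
    singular values. *)
Lemma gram_sigma A : exists2 P : 'M[C]_d, P \is unitarymx &
  (toC A)^t* *m toC A = P^t* *m diag_mx (\row_j cx (sigma A j ^+ 2)) *m P.
Proof.
have [P [e [Pu e0 HE]]] := gram_spectral A.
have [_ pe] := singular_values_spec Pu e0 HE.
have [p] : exists p : 'S_d, forall j : 'I_d, sigma A j ^+ 2 = e 0 (p j).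
  have sz : size [seq x ^+ 2 | x <- singular_values A] == d.
    by rewrite size_map size_singular_values.
  have sz' : size [seq e 0 j | j <- enum 'I_d] == d by rewrite size_map size_enum_ord.
  have /tuple_permP[p h] : perm_eq (Tuple sz) (Tuple sz') by [].
  exists p => j; have := congr1 (fun s => nth 0 s j) h.
  rewrite /= (nth_map 0) ?size_singular_values// => ->.
  rewrite (nth_map j) ?size_enum_ord// nth_ord_enum (tnth_nth 0)/=.
  by rewrite (nth_map j) ?size_enum_ord// nth_ord_enum.
move=> pE; exists (row_perm p P).
  exact: row_perm_unitary.
rewrite HE; apply/matrixP => i j; rewrite !mxE [RHS](reindex_inj (@perm_inj _ (p^-1)%g)) /=.
apply: eq_bigr => l _; rewrite mul_mx_diag [in RHS]mul_mx_diag !mxE permKV.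
by congr (_ * cx _ * _); rewrite pE permKV.
Qed.

End singular_values.

(** * Inequalities between singular values of products *)

Section singular_value_inequalities.
Context (R : realType) (d : nat).
Local Notation C := R[i].
Local Notation cx := (real_complex R).
Local Notation toC := (map_mx cx).
Implicit Types (A B : 'M[R]_d).

Definition prod_sigma A (k : nat) : R := \prod_(j < k) sigma A j.

Lemma prod_sigma_ge0 A k : 0 <= prod_sigma A k.
Proof. by apply: prodr_ge0 => j _; exact: sigma_ge0. Qed.

Lemma gram_form_diag A : exists2 P : 'M[C]_d, P \is unitarymx &
  forall k (X : 'M[C]_(d, k)),
    (toC A *m X)^t* *m (toC A *m X) =
    (P *m X)^t* *m diag_mx (\row_j cx (sigma A j ^+ 2)) *m (P *m X).
Proof.
have [P Pu HE] := gram_sigma A; exists P => // k X.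
by rewrite !trmx_mul !map_mxM !mulmxA -[in LHS](mulmxA _ _ (toC A)) HE !mulmxA.
Qed.

(** In an eigenbasis of the Gram matrix the form is diagonal, and any k distinct squared singular
    values have product at most that of the k largest. *)
Lemma det_gram_le A k (X : 'M[C]_(d, k)) :
  \det ((toC A *m X)^t* *m (toC A *m X)) <=
  cx (prod_sigma A k ^+ 2) * \det (X^t* *m X).
Proof.
have [P Pu HE] := gram_form_diag A.
rewrite HE -(gram_unitary X Pu); apply: det_form_diag_le => f fi.
under eq_bigr do rewrite mxE.
rewrite -rmorph_prod lecR /prod_sigma -prodrXl.
have := @prod_antitone_le R (fun j => sigma A j ^+ 2) [seq val (f i) | i <- enum 'I_k].
rewrite size_map size_enum_ord big_map big_enum/=; apply.
- by move=> i; rewrite sqr_ge0.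
- by move=> i j ij; rewrite ler_sqr ?nnegrE ?sigma_ge0// sigma_antitone.
- by rewrite map_inj_uniq ?enum_uniq// => x y /val_inj/(injectiveP _ fi).
Qed.

Lemma gram_form_ge A (X : 'M[C]_(d, 1)) :
  cx (sigma A d.-1 ^+ 2) * \det (X^t* *m X) <=
  \det ((toC A *m X)^t* *m (toC A *m X)).
Proof.
have [P Pu HE] := gram_form_diag A.
rewrite HE -(gram_unitary X Pu); apply: det_form_diag_ge => f fi.
rewrite big_ord1 mxE lecR ler_sqr ?nnegrE ?sigma_ge0// sigma_antitone//.
by have := ltn_ord (f ord0); case: (d) (f ord0).
Qed.

(** The columns of [X] are the right singular vectors of [A] with indices [h i]. *)
Lemma det_gram_attained A k (h : 'I_k -> 'I_d) : injective h ->
  exists X : 'M[C]_(d, k), X^t* *m X = 1%:M /\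
    \det ((toC A *m X)^t* *m (toC A *m X)) = cx (\prod_(i < k) sigma A (h i) ^+ 2).
Proof.
move=> hi; have [P Pu HE] := gram_form_diag A.
pose E : 'M[C]_(d, k) := colsub h 1%:M.
have EE (D : 'rV[C]_d) : E^t* *m diag_mx D *m E = diag_mx (\row_i D 0 (h i)).
  apply/matrixP => i j; rewrite mxE (bigD1 (h i))//= big1 ?addr0.
    rewrite mul_mx_diag !mxE eqxx conjC1 mul1r (inj_eq hi).
    by case: (i == j); rewrite ?mulr1 ?mulr0.
  move=> l lh; rewrite mul_mx_diag !mxE (negbTE lh) mulr0n conjC0 !mul0r//.
have PE : P *m (P^t* *m E) = E by rewrite mulmxA (unitarymxP Pu) mul1mx.
exists (P^t* *m E); split.
  rewrite -(gram_unitary _ Pu) PE.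
  have := EE (const_mx 1); rewrite diag_const_mx mulmx1 => ->.
  by apply/matrixP => i j; rewrite !mxE.
rewrite HE PE EE det_diag rmorph_prod/=.
by apply: eq_bigr => i _; rewrite !mxE.
Qed.

(** Evaluate the Gram determinant on the first k right singular vectors of [A *m B], where it is
    attained, and bound it by [det_gram_le] for [A] and then for [B]. *)
Lemma prod_sigmaM A B k : (k <= d)%N ->
  prod_sigma (A *m B) k <= prod_sigma A k * prod_sigma B k.
Proof.
move=> kd; rewrite -ler_sqr ?nnegrE ?mulr_ge0 ?prod_sigma_ge0//.
have wi : injective (widen_ord kd) by move=> x y /(congr1 val)/= /val_inj.
have [X [XX XE]] := det_gram_attained (A *m B) wi.
rewrite -lecR {1}/prod_sigma -prodrXl -XE map_mxM -mulmxA.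
apply: (le_trans (det_gram_le _ _)).
rewrite exprMn (rmorphM cx (_ ^+ 2)); apply: ler_wpM2l; first by rewrite ler0c sqr_ge0.
by apply: (le_trans (det_gram_le _ _)); rewrite XX det1 mulr1.
Qed.

Lemma prod_sigma_det A : prod_sigma A d = `|\det A|.
Proof.
have [X [XX XE]] := det_gram_attained A (@inj_id 'I_d).
apply/eqP; rewrite -(eqrXn2 (n := 2))// ?prod_sigma_ge0//.
rewrite real_normK ?num_real// /prod_sigma -prodrXl; apply/eqP/complexI.
rewrite -XE; have -> : (toC A *m X)^t* *m (toC A *m X) = X^t* *m toC (A^T *m A) *m X.
  by rewrite trmx_mul map_mxM toC_conj map_mxM !mulmxA.
rewrite 2!det_mulmx mulrAC -det_mulmx XX det1 mul1r det_map_mx det_mulmx det_tr.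
by rewrite expr2.
Qed.

(** Let Y be a unit right singular vector for the smallest singular value of [A], and X the preimage
    of Y under [B]. Then |ABX| is that singular value, while 1 = |Y| is at most [sigma B 0] times
    |X|; compare with the lower bound of |ABX| by |X|. *)
Lemma sigma_last_mul_le A B : (0 < d)%N -> B \in unitmx ->
  sigma (A *m B) d.-1 <= sigma A d.-1 * sigma B 0.
Proof.
move=> d0 Bu; rewrite -ler_sqr ?nnegrE ?mulr_ge0 ?sigma_ge0//.
have dd : (d.-1 < d)%N by rewrite prednK.
have [|Y [YY YE]] := @det_gram_attained A 1 (fun _ => Ordinal dd).
  by move=> i j _; rewrite !ord1.
have Bu' : toC B \in unitmx by rewrite map_unitmx.
pose X := invmx (toC B) *m Y.
have YX : Y = toC B *m X by rewrite mulKVmx.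
(* The 1 x 1 Gram determinant is the squared norm of [X], which is nonzero because [Y] is. *)
have XX0 : 0 < \det (X^t* *m X).
  rewrite det_mx11 mxE lt_neqAle; apply/andP; split; last first.
    by apply: sumr_ge0 => i _; rewrite !mxE -normCKC exprn_ge0.
  rewrite eq_sym; apply/eqP => X0; have XE i : X i 0 = 0.
    apply/eqP; rewrite -normr_eq0 -sqrf_eq0; apply/eqP; move: i isT.
    apply: (psumr_eq0P _) => [i _|]; first exact: exprn_ge0.
    by rewrite -[RHS]X0; apply: eq_bigr => i _; rewrite !mxE normCKC.
  have : X = 0 by apply/matrixP => i j; rewrite ord1 XE mxE.
  move=> X00; move: YY; rewrite YX X00 !mulmx0 => /matrixP/(_ 0 0).
  by rewrite !mxE eqxx => /esym/eqP; rewrite oner_eq0.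
rewrite -lecR -(ler_pM2r XX0) exprMn (rmorphM cx (_ ^+ 2)) -[leRHS]mulrA.
apply: (le_trans (gram_form_ge _ _)).
rewrite map_mxM -mulmxA -YX YE big_ord1; apply: ler_peMr; first by rewrite ler0c sqr_ge0.
have := det_gram_le B X; rewrite /prod_sigma big_ord1 -YX; apply: le_trans.
by rewrite YY det1.
Qed.

Lemma sigma0_1 : (0 < d)%N -> sigma (1%:M : 'M[R]_d) 0 = 1.
Proof.
move=> d0; have [|X [XX]] := @det_gram_attained 1%:M 1 (fun _ => Ordinal d0).
  by move=> i j _; rewrite !ord1.
rewrite map_mx1 mul1mx XX det1 big_ord1 => /complexI/esym/eqP.
by rewrite -[X in _ == X](expr1n _ 2) eqrXn2// ?sigma_ge0// => /eqP.
Qed.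

Lemma sigma0_mul_le A B : (0 < d)%N -> sigma (A *m B) 0 <= sigma A 0 * sigma B 0.
Proof. by move=> d0; have := @prod_sigmaM A B 1 d0; rewrite /prod_sigma !big_ord1. Qed.

Lemma sigma_gt0 A j : A \in unitmx -> (j < d)%N -> 0 < sigma A j.
Proof.
move=> Au jd; rewrite lt_neqAle sigma_ge0 andbT eq_sym; apply/eqP => s0.
have : prod_sigma A d = 0 by rewrite /prod_sigma (bigD1 (Ordinal jd))//= s0 mul0r.
rewrite prod_sigma_det => /eqP; rewrite normr_eq0 => /eqP d0.
by move: Au; rewrite unitmxE d0 unitr0.
Qed.

Lemma prod_sigma_gt0 A k : A \in unitmx -> (k <= d)%N -> 0 < prod_sigma A k.
Proof.
move=> Au kd; apply: prodr_gt0 => j _; apply: sigma_gt0 => //.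
exact: leq_trans (ltn_ord j) kd.
Qed.

End singular_value_inequalities.

(** * The singular value function *)

Lemma powRD_gt0 (R : realType) (x r s : R) : 0 < x -> x `^ (r + s) = x `^ r * x `^ s.
Proof. by move=> x0; rewrite powRD// (gt_eqF x0) implybT. Qed.

Section singular_value_function.
Context (R : realType) (d : nat).
Hypothesis d_gt0 : (0 < d)%N.
Implicit Types (A B : 'M[R]_d) (s : R).

(* The exponent of [sigma A j] in [Phi s A]. *)
Definition expo s (j : nat) : R :=
  if (j < d.-1)%N then Num.min 1 (Num.max 0 (s - j%:R)) else Num.max 0 (s - j%:R).

Lemma expo_le s s' j : s' <= s -> expo s' j <= expo s j.
Proof.
move=> ss; have h : Num.max 0 (s' - j%:R) <= Num.max 0 (s - j%:R).
  by rewrite ge_max !le_max lexx/= lerD2r ss orbT.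
by rewrite /expo; case: ifP => // _; rewrite le_min !ge_min lexx/= h orbT.
Qed.

Lemma expo_ge0 s j : 0 <= expo s j.
Proof. by rewrite /expo; case: ifP => _; rewrite ?le_min ?le_max lexx ?ler01. Qed.

(** An arbitrary monoid law lets one computation serve both for the sum of the exponents and for the
    product defining [Phi]: the exponents are 1 up to the critical index, then the remaining
    fraction, then 0, the last one being uncapped when s is at least d. *)
Lemma big_expo (T : Type) (idx : T) (op : Monoid.law idx) (f : nat -> R -> T) s :
  (forall j, f j 0 = idx) -> 0 <= s ->
  \big[op/idx]_(j < d) f j (expo s j) =
  if s < d%:R then
    op (\big[op/idx]_(j < Num.truncn s) f j 1) (f (Num.truncn s) (s - (Num.truncn s)%:R))
  else op (\big[op/idx]_(j < d.-1) f j 1) (f d.-1 (s - d%:R + 1)).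
Proof.
move=> f0 s0; have dE : d = d.-1.+1 by rewrite prednK.
have e1 j : (j < d.-1)%N -> j.+1%:R <= s -> expo s j = 1.
  move=> jd js; rewrite /expo jd (max_idPr _) ?min_l//.
    by rewrite lerBrDr -natr1 addrC in js *.
  by rewrite subr_ge0 (le_trans _ js)// ler_nat.
case: ifPn => sd.
  have /andP[ks sk] := truncn_itv s0.
  set k := Num.truncn s in ks sk *.
  have kd : (k < d)%N by rewrite -(ltr_nat R) (le_lt_trans ks).
  rewrite -(big_mkord xpredT (fun j => f j (expo s j))).
  rewrite (big_cat_nat (n := k))//=; last exact: ltnW.
  have tail : \big[op/idx]_(k.+1 <= j < d) f j (expo s j) = idx.
    rewrite big_nat_cond big1// => j; rewrite andbT => /andP[kj jd].
    rewrite /expo max_l ?min_r ?ler01// ?if_same ?f0// subr_le0 ltW//.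
    by rewrite (lt_le_trans sk)// ler_nat.
  rewrite [X in op _ X]big_ltn// tail Monoid.mulm1 big_mkord; congr (op _ (f _ _)).
    apply: eq_bigr => j _; rewrite e1//.
      have := ltn_ord j; lia.
    by rewrite (le_trans _ ks)// ler_nat ltn_ord.
  rewrite /expo max_r ?subr_ge0//; case: ifP => // _.
  by rewrite min_r// lerBlDr addrC natr1 ltW.
rewrite -leNgt in sd; rewrite -(big_mkord xpredT (fun j => f j (expo s j))).
rewrite [X in \big[_/_]_(0 <= _ < X) _]dE.
rewrite big_nat_recr//= big_mkord.
congr (op _ (f _ _)).
  apply: eq_bigr => j _; rewrite e1// (le_trans _ sd)// ler_nat.
  have := ltn_ord j; lia.
rewrite /expo ltnn [in RHS]dE -natr1 max_r; first by rewrite opprD addrA subrK.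
by rewrite subr_ge0 (le_trans _ sd)// ler_nat leq_pred.
Qed.

Lemma sum_expo s : 0 <= s -> \sum_(j < d) expo s j = s.
Proof.
move=> s0; rewrite (@big_expo R 0 +%R (fun _ e => e))//.
case: ifPn => _; rewrite sumr_const card_ord /=; first by rewrite addrC subrK.
by rewrite -[X in _ + (_ - X%:R + _)](prednK d_gt0) -natr1; lra.
Qed.

Lemma PhiE A s : 0 <= s -> Phi s A = \prod_(j < d) sigma A j `^ expo s j.
Proof.
move=> s0; rewrite (@big_expo R 1 *%R (fun j e => sigma A j `^ e))//; last first.
  by move=> j; rewrite powRr0.
rewrite /Phi; case: ifP => _; congr (_ * _); apply: eq_bigr => j _;
  by rewrite powRr1// sigma_ge0.
Qed.

Lemma Phi_gt0 A s : A \in unitmx -> 0 <= s -> 0 < Phi s A.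
Proof.
move=> Au s0; rewrite PhiE//; apply: prodr_gt0 => j _.
by rewrite powR_gt0// sigma_gt0.
Qed.

Lemma Phi0 A : Phi 0 A = 1.
Proof.
rewrite PhiE// big1// => j _; rewrite /expo sub0r max_l ?oppr_le0//.
by rewrite min_r ?ler01// if_same powRr0.
Qed.

Lemma prod_powR (x : R) (n : nat) (g : 'I_n -> R) : 0 < x ->
  \prod_(j < n) x `^ g j = x `^ (\sum_(j < n) g j).
Proof.
move=> x0; rewrite (big_morph (fun e => x `^ e) (id1 := 1) (op1 := *%R))//.
  by move=> a b; rewrite powRD_gt0.
by rewrite powRr0.
Qed.

(** The differences of the exponents are nonnegative with sum s - s', and every singular value is at
    most [th]. *)
Lemma Phi_le A s s' (th : R) : A \in unitmx -> 0 < th -> sigma A 0 <= th ->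
  0 <= s' -> s' <= s -> Phi s A <= th `^ (s - s') * Phi s' A.
Proof.
move=> Au th0 Ath s'0 s's; have s0 := le_trans s'0 s's.
have -> : s - s' = \sum_(j < d) (expo s j - expo s' j).
  by rewrite sumrB !sum_expo.
rewrite -prod_powR// !PhiE// -big_split/=; apply: ler_prod => j _.
rewrite powR_ge0/=.
have sj : 0 < sigma A j by rewrite sigma_gt0.
have -> : expo s j = (expo s j - expo s' j) + expo s' j by rewrite subrK.
rewrite powRD_gt0//.
rewrite addrK ler_wpM2r ?powR_ge0//; apply: ge0_ler_powR => //.
- by rewrite subr_ge0 expo_le.
- by rewrite nnegrE ltW.
- by rewrite nnegrE ltW.
- exact: le_trans (sigma_antitone _ (leq0n _)) Ath.
Qed.

Lemma Phi_ge A s (th : R) : 0 < th -> 0 <= s ->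
  (forall j, (j < d)%N -> th <= sigma A j) -> th `^ s <= Phi s A.
Proof.
move=> th0 s0 thA; rewrite PhiE// -{1}(sum_expo s0) -prod_powR//.
apply: ler_prod => j _; rewrite powR_ge0/=; apply: ge0_ler_powR => //.
- exact: expo_ge0.
- by rewrite nnegrE ltW.
- by rewrite nnegrE (le_trans (ltW th0))// thA.
- exact: thA.
Qed.

(** With t = s - k, the function is the weighted geometric mean of the products of the k and of the
    k + 1 largest singular values, with weights 1 - t and t; both products are submultiplicative. *)
Lemma Phi_submul A B s : A \in unitmx -> B \in unitmx -> 0 <= s -> s < d%:R ->
  Phi s (A *m B) <= Phi s A * Phi s B.
Proof.
move=> Au Bu s0 sd; have ABu : A *m B \in unitmx by rewrite unitmx_mul Au.
rewrite /Phi sd; have /andP[ks sk] := truncn_itv s0.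
move: (Num.truncn s) ks sk => k ks sk; set t := s - k%:R.
have kd : (k < d)%N by rewrite -(ltr_nat R) (le_lt_trans ks).
have t0 : 0 <= t by rewrite subr_ge0.
have t1 : 0 <= 1 - t by rewrite subr_ge0 lerBlDr addrC natr1 ltW.
clearbody t.
have E (X : 'M[R]_d) : X \in unitmx -> (\prod_(j < k) sigma X j) * sigma X k `^ t =
    prod_sigma X k `^ (1 - t) * prod_sigma X k.+1 `^ t.
  move=> Xu; have Xk := prod_sigma_gt0 Xu (ltnW kd).
  rewrite {2}/prod_sigma big_ord_recr/= powRM ?sigma_ge0//; last exact: ltW.
  by rewrite mulrA -powRD_gt0// subrK powRr1// ltW.
rewrite (E _ ABu) (E _ Au) (E _ Bu) mulrACA.
have M j (r : R) : 0 <= r -> (j <= d)%N ->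
    prod_sigma (A *m B) j `^ r <= prod_sigma A j `^ r * prod_sigma B j `^ r.
  move=> r0 jd; rewrite -(powRM r (prod_sigma_ge0 A j) (prod_sigma_ge0 B j)).
  by apply: ge0_ler_powR; rewrite // ?nnegrE ?mulr_ge0 ?prod_sigma_ge0// prod_sigmaM.
have m1 := M k (1 - t) t1 (ltnW kd).
have m2 := M k.+1 t t0 kd.
exact: (ler_pM (powR_ge0 _ _) (powR_ge0 _ _) m1 m2).
Qed.

Lemma prod_sigma_last A : prod_sigma A d = prod_sigma A d.-1 * sigma A d.-1.
Proof.
have : prod_sigma A d.-1.+1 = prod_sigma A d.-1 * sigma A d.-1.
  by rewrite /prod_sigma big_ord_recr.
by rewrite prednK.
Qed.

Lemma Phi_last A s : A \in unitmx -> d%:R <= s ->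
  Phi s A = `|\det A| * sigma A d.-1 `^ (s - d%:R).
Proof.
move=> Au ds; rewrite /Phi ltNge ds/= -prod_sigma_det /prod_sigma.
have sp : 0 < sigma A d.-1 by rewrite sigma_gt0// prednK.
rewrite powRD_gt0//.
by rewrite powRr1 ?ltW// -/(prod_sigma A d) prod_sigma_last -mulrA [sigma A d.-1 * _]mulrC.
Qed.

Lemma Phi_1 s : 0 <= s -> Phi s (1%:M : 'M[R]_d) = 1.
Proof.
move=> s0; have s1 j : sigma (1%:M : 'M[R]_d) j <= 1.
  by rewrite (le_trans (sigma_antitone _ (leq0n _)))// sigma0_1.
rewrite PhiE// big1// => j _; suff -> : sigma (1%:M : 'M[R]_d) j = 1 by rewrite powR1.
apply/eqP; rewrite eq_le s1 -[leLHS](normr1 R) -[X in `|X| <= _](det1 R d) -prod_sigma_det.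
rewrite /prod_sigma (bigD1 j)//= ler_piMr ?sigma_ge0//.
by apply: prodr_ile1 => i _; rewrite sigma_ge0 s1.
Qed.

(** The product of all singular values is multiplicative, being |det|, and that of the first d - 1
    is submultiplicative; the quotient is the last one. *)
Lemma sigma_last_supermul A B : A \in unitmx -> B \in unitmx ->
  sigma A d.-1 * sigma B d.-1 <= sigma (A *m B) d.-1.
Proof.
move=> Au Bu; have ABu : A *m B \in unitmx by rewrite unitmx_mul Au.
have := prod_sigma_det (A *m B).
rewrite det_mulmx normrM -!prod_sigma_det !prod_sigma_last mulrACA => h.
have p := prod_sigma_gt0 ABu (leq_pred d).
rewrite -(ler_pM2l p) h ler_wpM2r ?mulr_ge0 ?sigma_ge0//.
by rewrite prod_sigmaM// leq_pred.
Qed.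

Lemma Phi_supermul A B s : A \in unitmx -> B \in unitmx -> d%:R <= s ->
  Phi s A * Phi s B <= Phi s (A *m B).
Proof.
move=> Au Bu ds; have ABu : A *m B \in unitmx by rewrite unitmx_mul Au.
rewrite !Phi_last// det_mulmx normrM mulrACA ler_wpM2l ?mulr_ge0//.
rewrite -powRM ?sigma_ge0//; apply: ge0_ler_powR.
- by rewrite subr_ge0.
- by rewrite nnegrE mulr_ge0 ?sigma_ge0.
- by rewrite nnegrE sigma_ge0.
- exact: sigma_last_supermul.
Qed.

Lemma Phi_le1 A s : A \in unitmx -> sigma A 0 <= 1 -> 0 <= s -> Phi s A <= 1.
Proof.
move=> Au A1 s0; have := Phi_le Au ltr01 A1 (lexx 0) s0.
by rewrite Phi0 powR1 mulr1.
Qed.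

(** Below d this is submultiplicativity. From d on, both the determinant and the smallest singular
    value decrease on multiplication by the contraction [B]. *)
Lemma Phi_mul_le A B s : A \in unitmx -> B \in unitmx -> sigma B 0 <= 1 -> 0 <= s ->
  Phi s (A *m B) <= Phi s A.
Proof.
move=> Au Bu B1 s0; have ABu : A *m B \in unitmx by rewrite unitmx_mul Au.
have [ds|sd] := leP d%:R s; last first.
  apply: (le_trans (Phi_submul Au Bu s0 sd)).
  by rewrite ler_piMr ?Phi_le1// ltW// Phi_gt0.
rewrite (Phi_last ABu ds) (Phi_last Au ds) det_mulmx normrM -mulrA.
apply: ler_wpM2l => //.
have d1 : `|\det B| <= 1.
  rewrite -prod_sigma_det /prod_sigma; apply: prodr_ile1 => j _.
  by rewrite sigma_ge0/= (le_trans (sigma_antitone _ (leq0n _))).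
apply: (@le_trans _ _ (sigma (A *m B) d.-1 `^ (s - d%:R))).
  by rewrite ler_piMl ?powR_ge0.
apply: ge0_ler_powR; rewrite ?nnegrE ?sigma_ge0 ?subr_ge0//.
apply: (le_trans (sigma_last_mul_le A d_gt0 Bu)).
by rewrite ler_piMr ?sigma_ge0.
Qed.

End singular_value_function.

(** * Words and necks *)

Section words.
Context (T : finType).

(** Words are kept as plain sequences rather than tuples, so that a sum over words of length m + n
    splits along concatenation without casts. *)
Fixpoint words n : seq (seq T) :=
  if n is n'.+1 then [seq i :: u | i <- enum T, u <- words n'] else [:: [::]].

Lemma mem_words n u : (u \in words n) = (size u == n).
Proof.
elim: n u => [|n ih] [|i u] //=; first by apply/allpairsP => -[[? ?] []].
rewrite eqSS -ih; apply/allpairsP/idP => [[[j v] /= [_ vn [_ ->]]]//|un].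
by exists (i, u); rewrite mem_enum.
Qed.

Lemma words_uniq n : uniq (words n).
Proof.
by elim: n => // n ih; apply: allpairs_uniq => //; [exact: enum_uniq|move=> [? ?] [? ?] _ _ [-> ->]].
Qed.

Lemma size_words n : size (words n) = (#|T| ^ n)%N.
Proof. by elim: n => // n ih; rewrite size_allpairs ih -cardE expnS. Qed.

Lemma sum_words_add (V : nmodType) m n (f : seq T -> V) :
  \sum_(u <- words (m + n)) f u = \sum_(u <- words m) \sum_(v <- words n) f (u ++ v).
Proof.
elim: m f => [|m ih] f; first by rewrite big_seq1.
rewrite addSn /= !big_allpairs_dep; apply: eq_bigr => i _.
by rewrite (ih (fun u => f (i :: u))).
Qed.

Lemma sum_tuple_words (V : nmodType) n (P : pred (seq T)) (f : seq T -> V) :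
  \sum_(u : n.-tuple T | P u) f u = \sum_(u <- words n | P u) f u.
Proof.
transitivity (\sum_(u <- enum {: n.-tuple T} | P u) f u).
  by rewrite big_enum_cond; apply: eq_bigl.
rewrite -(big_map val P f)/=; apply: perm_big; apply: uniq_perm.
- by rewrite map_inj_uniq ?enum_uniq//; exact: val_inj.
- exact: words_uniq.
- move=> u; rewrite mem_words; apply/mapP/eqP => [[t _ ->]|un]; first exact: size_tuple.
  by exists (Tuple (introT eqP un)); rewrite // mem_enum.
Qed.

End words.

Lemma word_map_cat (R : realType) (d : nat) (L : topologicalType)
  (F : affineFamily R d L) (t : seq 'I_(maxmaps F) -> option L) u v :
  word_map t (u ++ v) = word_map t u *m word_map (fun x => t (u ++ x)) v.
Proof.
elim: u t => [|i u ih] t /=; first by rewrite mul1mx.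
by rewrite ih mulmxA.
Qed.

Section necks.
Context (R : realType) (d : nat) (L : topologicalType) (F : affineFamily R d L).
Implicit Types (w : codeTree F) (u v : seq 'I_(maxmaps F)).

(* [level w m] is N_m, with N_0 = 0. *)
Definition level w m : nat := if m is m'.+1 then neck w m' else 0.

Lemma level_lt w m : (level w m < level w m.+1)%N.
Proof. by case: m => [|m] /=; [exact: neck_gt0|exact: neck_incr]. Qed.

Lemma level_le w m n : (m <= n)%N -> (level w m <= level w n)%N.
Proof.
elim: n => [|n ih]; first by rewrite leqn0 => /eqP ->.
rewrite leq_eqVlt => /predU1P[->//|mn].
exact: leq_trans (ih mn) (ltnW (level_lt w n)).
Qed.

Lemma leq_level w m : (m <= level w m)%N.
Proof. by elim: m => // m ih; exact: leq_ltn_trans ih (level_lt w m). Qed.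

Definition Xin m w : codeTree F := iter m (@Xi _ _ _ F) w.

Lemma XinS m w : Xin m.+1 w = Xin m (Xi w).
Proof. exact: iterSr. Qed.

Lemma XinD m n w : Xin (m + n) w = Xin n (Xin m w).
Proof. by rewrite addnC /Xin iterD. Qed.

Lemma level_Xi m w : level (Xi w) m = (level w m.+1 - level w 1)%N.
Proof. by case: m => [|m] //=; rewrite subnn. Qed.

Lemma level_Xin m n w : level (Xin m w) n = (level w (m + n) - level w m)%N.
Proof.
elim: m n w => [|m ih] n w; first by rewrite subn0.
rewrite XinS ih !level_Xi addSn subnBA ?level_le// subnK ?level_le//.
Qed.

Lemma level_split m n w : level w (m + n) = (level w m + level (Xin m w) n)%N.
Proof. by rewrite level_Xin subnKC// level_le// leq_addr. Qed.

Lemma tree_Xin m w u v : size u = level w m -> isSome (tree w u) ->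
  tree (Xin m w) v = tree w (u ++ v).
Proof.
elim: m w u => [|m ih] w u; first by move/size0nil ->.
move=> su wu; pose u1 := take (level w 1) u; pose u2 := drop (level w 1) u.
have le1 : (level w 1 <= size u)%N by rewrite su level_le.
have s1 : size u1 = neck w 0 by rewrite size_takel.
have wu1 : isSome (tree w u1).
  by apply: (@tree_prefix _ _ _ _ _ _ u2); rewrite cat_take_drop.
have h x : tree (Xi w) x = tree w (u1 ++ x) by exact: shift_treeE.
rewrite XinS (ih _ u2); first by rewrite h catA cat_take_drop.
  by rewrite size_drop su level_Xi.
by rewrite h cat_take_drop.
Qed.

Lemma tree_Xin_cat m w u v : size u = level w m ->
  isSome (tree w (u ++ v)) = isSome (tree w u) && isSome (tree (Xin m w) v).
Proof.
move=> su; case wu : (isSome (tree w u)); first by rewrite (tree_Xin _ su wu).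
by apply/negbTE; apply: contraFN wu; exact: tree_prefix.
Qed.

Lemma word_map_Xin m w u v : size u = level w m -> isSome (tree w u) ->
  word_map (tree w) (u ++ v) = word_map (tree w) u *m word_map (tree (Xin m w)) v.
Proof.
move=> su wu; rewrite word_map_cat; congr (_ *m word_map _ _).
by apply/funext => x; rewrite (tree_Xin _ su wu).
Qed.

Lemma maxmaps_gt0 : (0 < maxmaps F)%N.
Proof.
have [l _] := nmaps_sup F.
exact: leq_trans (nmaps_gt0 F l) (nmaps_le F l).
Qed.

Lemma tree_rcons w u i : isSome (tree w (rcons u i)) ->
  exists l (j : 'I_(nmaps (F l))), word_map (tree w) (rcons u i) =
    word_map (tree w) u *m linear_part j.
Proof.
rewrite tree_step -cats1 word_map_cat /= mulmx1 cats0.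
case: (tree w u) => // l il; exists l, (Ordinal il); congr (_ *m _).
by rewrite /= insubT.
Qed.

End necks.

(** * The singular value function along words *)

Section word_weights.
Context (R : realType) (d : nat) (L : topologicalType) (F : affineFamily R d L).
Hypothesis d_gt0 : (0 < d)%N.
Variables lo hi : R.
Hypotheses (lo_gt0 : 0 < lo) (hi_gt0 : 0 < hi) (hi_lt1 : hi < 1).
Hypothesis bounds : forall l (i : 'I_(nmaps (F l))) j, (j < d)%N ->
  lo <= sigma (linear_part i) j <= hi.
Implicit Types (w : codeTree F) (u v : seq 'I_(maxmaps F)) (s : R).

Definition wt s w u : R := Phi s (word_map (tree w) u).

Lemma word_map_unit w u : isSome (tree w u) -> word_map (tree w) u \in unitmx.
Proof.
elim/last_ind: u => [|u i ih] wu; first by rewrite unitmx1.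
have [l [j ->]] := tree_rcons wu; rewrite unitmx_mul linear_part_unit andbT.
by apply: ih; apply: (@tree_prefix _ _ _ _ _ _ [:: i]); rewrite cats1.
Qed.

Lemma sigma0_word_map w u : isSome (tree w u) ->
  sigma (word_map (tree w) u) 0 <= hi ^+ size u.
Proof.
elim/last_ind: u => [|u i ih] wu; first by rewrite sigma0_1.
have [l [j ->]] := tree_rcons wu; apply: (le_trans (sigma0_mul_le _ _ d_gt0)).
rewrite size_rcons exprSr; apply: ler_pM; rewrite ?sigma_ge0//.
  by apply: ih; apply: (@tree_prefix _ _ _ _ _ _ [:: i]); rewrite cats1.
by have /andP[] := bounds j d_gt0.
Qed.

Lemma wt_gt0 s w u : isSome (tree w u) -> 0 <= s -> 0 < wt s w u.
Proof. by move=> wu s0; rewrite Phi_gt0// word_map_unit. Qed.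

Lemma wt_le1 s w u : isSome (tree w u) -> 0 <= s -> wt s w u <= 1.
Proof.
move=> wu s0; apply: Phi_le1 => //; first exact: word_map_unit.
apply: (le_trans (sigma0_word_map wu)); apply: exprn_ile1; exact: ltW.
Qed.

Lemma wt_prefix s w u v : isSome (tree w (u ++ v)) -> 0 <= s ->
  wt s w (u ++ v) <= wt s w u.
Proof.
move=> + s0; elim/last_ind: v => [|v i ih]; first by rewrite cats0.
rewrite -rcons_cat => wv; have wuv : isSome (tree w (u ++ v)).
  by apply: (@tree_prefix _ _ _ _ _ _ [:: i]); rewrite cats1.
apply: le_trans (ih wuv); have [l [j]] := tree_rcons wv; rewrite /wt => ->.
apply: Phi_mul_le => //; [exact: word_map_unit|exact: linear_part_unit|].
by have /andP[_ h] := bounds j d_gt0; exact: le_trans h (ltW hi_lt1).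
Qed.

Lemma wt_decr s s' w u : isSome (tree w u) -> 0 <= s' -> s' <= s ->
  wt s w u <= (hi `^ (s - s')) ^+ size u * wt s' w u.
Proof.
move=> wu s'0 s's.
have -> : (hi `^ (s - s')) ^+ size u = (hi ^+ size u) `^ (s - s').
  by rewrite -powR_mulrn ?powR_ge0// -powRrM mulrC powRrM powR_mulrn// ltW.
apply: Phi_le => //; [exact: word_map_unit|exact: exprn_gt0|exact: sigma0_word_map].
Qed.

Lemma wt_submul s w m u v : 0 <= s -> s < d%:R -> size u = level w m ->
  isSome (tree w (u ++ v)) -> wt s w (u ++ v) <= wt s w u * wt s (Xin m w) v.
Proof.
move=> s0 sd su; rewrite (tree_Xin_cat _ su) => /andP[wu wv].
by rewrite /wt (word_map_Xin _ su wu) Phi_submul// word_map_unit.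
Qed.

Lemma wt_supermul s w m u v : d%:R <= s -> size u = level w m ->
  isSome (tree w (u ++ v)) -> wt s w u * wt s (Xin m w) v <= wt s w (u ++ v).
Proof.
move=> ds su; rewrite (tree_Xin_cat _ su) => /andP[wu wv].
by rewrite /wt (word_map_Xin _ su wu) Phi_supermul// word_map_unit.
Qed.

(** The matrix of the tail is that of the whole word multiplied by the inverse of the prefix matrix,
    and [Phi] of that inverse is the constant. *)
Lemma wt_tail s w m u : 0 <= s -> s < d%:R -> size u = level w m ->
  isSome (tree w u) -> exists2 c, 0 < c &
    forall v, isSome (tree w (u ++ v)) -> wt s (Xin m w) v <= c * wt s w (u ++ v).
Proof.
move=> s0 sd su wu; have Uu := word_map_unit wu.
exists (Phi s (invmx (word_map (tree w) u))).
  by rewrite Phi_gt0// unitmx_inv.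
move=> v wuv; have := wuv; rewrite (tree_Xin_cat _ su) => /andP[_ wv].
rewrite /wt; have -> : word_map (tree (Xin m w)) v =
    invmx (word_map (tree w) u) *m word_map (tree w) (u ++ v).
  by rewrite (word_map_Xin _ su wu) mulKmx.
by rewrite Phi_submul// ?unitmx_inv// word_map_unit.
Qed.

Lemma wt_lower s w u : d%:R <= s -> isSome (tree w u) ->
  (lo `^ s) ^+ size u <= wt s w u.
Proof.
move=> ds; have s0 := le_trans (ler0n _ _) ds.
elim/last_ind: u => [|u i ih] wu; first by rewrite expr0 /wt /= Phi_1.
have wu' : isSome (tree w u).
  by apply: (@tree_prefix _ _ _ _ _ _ [:: i]); rewrite cats1.
have [l [j]] := tree_rcons wu; rewrite /wt => ->.
apply: le_trans (Phi_supermul _ _ _ ds) => //; last 2 first.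
- exact: word_map_unit.
- exact: linear_part_unit.
rewrite size_rcons exprSr; apply: ler_pM; rewrite ?exprn_ge0 ?powR_ge0//.
  exact: ih.
by apply: Phi_ge => // q qd; have /andP[] := bounds j qd.
Qed.

End word_weights.

(** * Covers by words ending at necks *)

Section agreement.
Context (R : realType) (d : nat) (L : topologicalType) (F : affineFamily R d L).
Implicit Types (w : codeTree F) (u v : seq 'I_(maxmaps F)).

(** Labels at words of length exactly [level w m] are included, whereas a basic cylinder stops just
    short of its last neck. *)
Definition agree m w w' :=
  (forall i, (i <= m)%N -> level w' i = level w i) /\
  (forall u, (size u <= level w m)%N -> tree w' u = tree w u).

Lemma agree_le m n w w' : (n <= m)%N -> agree m w w' -> agree n w w'.
Proof.
move=> nm [a b]; split => [i im|u uw]; first exact/a/(leq_trans im).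
by apply: b; exact: leq_trans uw (level_le w nm).
Qed.

Lemma agree_Xi m w w' : agree m.+1 w w' -> agree m (Xi w) (Xi w').
Proof.
move=> [a b]; split => [i im|v]; first by rewrite !level_Xi !a.
rewrite level_Xi => vm; have [sw ww] := neck_wordP w.
have E : tree w' (neck_word w) = tree w (neck_word w).
  by rewrite b// sw (level_le w (ltn0Sn m)).
rewrite (shift_treeE (u := neck_word w)) ?E//; last first.
  by rewrite sw; have := a 1%N isT.
rewrite (shift_treeE (u := neck_word w))// b// size_cat sw.
by move: vm; rewrite /level -/(level w 1) => vm; rewrite -leq_subRL// (level_le w (ltn0Sn m)).
Qed.

Lemma agree_Xin k m w w' : agree (k + m) w w' -> agree m (Xin k w) (Xin k w').
Proof. by elim: k w w' => // k ih w w' h; rewrite !XinS; exact/ih/agree_Xi. Qed.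

Lemma word_map_eq (t t' : seq 'I_(maxmaps F) -> option L) u :
  (forall v, (size v < size u)%N -> t v = t' v) -> word_map t u = word_map t' u.
Proof.
elim: u t t' => // i u ih t t' h /=; rewrite h//; congr (_ *m _).
by apply: ih => v vu; apply: h; rewrite /= ltnS.
Qed.

End agreement.

Section covers.
Context (R : realType) (d : nat) (L : topologicalType) (F : affineFamily R d L).
Implicit Types (w : codeTree F) (u v : seq 'I_(maxmaps F)) (eps : R).

(** The interface of the covering argument, met by the singular value function below d and by its
    block products from d on. [weight_tail] serves to pass from a code tree to its shift,
    [weight_local] serves measurability. *)
Record weight (s : R) (psi : nat -> codeTree F -> seq 'I_(maxmaps F) -> R) : Prop :=
 Weight {
  weight0 : forall w, psi 0 w [::] = 1;
  weight_gt0 : forall m w u, size u = level w m -> isSome (tree w u) -> 0 < psi m w u;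
  weight_le_wt : forall m w u, size u = level w m -> isSome (tree w u) ->
    psi m w u <= wt s w u;
  weight_submul : forall m n w u v, size u = level w m -> size v = level (Xin m w) n ->
    isSome (tree w (u ++ v)) -> psi (m + n)%N w (u ++ v) <= psi m w u * psi n (Xin m w) v;
  weight_tail : forall w u, size u = level w 1 -> isSome (tree w u) ->
    exists2 c, 0 < c & forall n v, size v = level (Xi w) n -> isSome (tree w (u ++ v)) ->
      psi n (Xi w) v <= c * psi n.+1 w (u ++ v);
  weight_local : forall m w w' u, agree m w w' -> size u = level w m ->
    psi m w' u = psi m w u
 }.

Variables (s : R) (psi : nat -> codeTree F -> seq 'I_(maxmaps F) -> R).
Hypothesis wpsi : weight s psi.

Definition level_sum n w : R :=
  \sum_(u <- words _ (level w n) | isSome (tree w u)) psi n w u.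

Definition cover_sum w l (J : pred (seq 'I_(maxmaps F))) : R :=
  \sum_(m < l.+1) \sum_(u <- words _ (level w m) | isSome (tree w u) && J u) psi m w u.

(** Only the words of [J] of lengths N_0, ..., N_l count, so that covering becomes a finite
    condition on the words of length N_l. *)
Definition covered w l eps := exists2 J : pred (seq 'I_(maxmaps F)),
  (forall u, size u = level w l -> isSome (tree w u) ->
    exists2 m, (m <= l)%N & J (take (level w m) u)) & cover_sum w l J < eps.

Definition null_covers : set (codeTree F) :=
  [set w | forall eps, 0 < eps -> exists l, covered w l eps].

Lemma covered_agree w w' l eps : agree l w w' -> covered w l eps -> covered w' l eps.
Proof.
move=> ag [J Jc Js]; have [a b] := ag; exists J.
  move=> u; rewrite a// => su; rewrite b ?su// => wu.
  by have [m ml Jm] := Jc u su wu; exists m; rewrite // a.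
congr (_ < _): Js; apply: eq_bigr => m _; have ml : (m <= l)%N by rewrite -ltnS.
rewrite a// big_seq_cond [RHS]big_seq_cond; apply: eq_big => u.
  rewrite mem_words; case: eqP => //= su; rewrite b// su; exact: level_le.
rewrite mem_words => /andP[/eqP su _]; apply/esym/(weight_local wpsi) => //.
exact: agree_le ag.
Qed.

Lemma level_sum_gt0 n w : 0 < level_sum n w.
Proof.
have [u [su wu]] := tree_word w (level w n).
rewrite /level_sum big_mkcond (bigD1_seq u)/= ?words_uniq ?mem_words ?su//.
rewrite wu ltr_wpDr ?(weight_gt0 wpsi)//.
rewrite big_seq_cond; apply: sumr_ge0 => v; rewrite mem_words => /andP[/eqP sv _].
by case: ifPn => // wv; apply/ltW/(weight_gt0 wpsi).
Qed.

(** Beyond a neck the possible continuations do not depend on the prefix, and the weight is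
    submultiplicative there. *)
Lemma level_sum_split m n w (Q : pred (seq 'I_(maxmaps F))) : (m <= n)%N ->
  \sum_(u <- words _ (level w n) | isSome (tree w u) && Q (take (level w m) u)) psi n w u
  <= (\sum_(v <- words _ (level w m) | isSome (tree w v) && Q v) psi m w v) *
     level_sum (n - m) (Xin m w).
Proof.
move=> mn; rewrite big_mkcond/=.
have -> : level w n = (level w m + level (Xin m w) (n - m))%N.
  by rewrite -level_split subnKC.
rewrite sum_words_add mulr_suml [leRHS]big_mkcond/=.
rewrite big_seq [leRHS]big_seq; apply: ler_sum => u; rewrite mem_words => /eqP su.
case: ifPn => [/andP[wu Qu]|wQu]; last first.
  rewrite big1_seq// => v /= _; case: ifPn => // /andP[wuv Quv].
  by move: wQu; rewrite (tree_prefix wuv); rewrite take_size_cat// in Quv; rewrite Quv.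
rewrite mulr_sumr big_mkcond [leRHS]big_mkcond/= big_seq [leRHS]big_seq.
apply: ler_sum => v; rewrite mem_words => /eqP sv.
rewrite take_size_cat// Qu andbT (tree_Xin_cat _ su) wu /=.
case: ifPn => // wv; have := weight_submul wpsi su sv; rewrite subnKC//; apply.
by rewrite (tree_Xin_cat _ su) wu.
Qed.

Lemma cover_sum_nil w l J : cover_sum w l J < 1 -> ~~ J [::].
Proof.
apply: contraTN => J0; rewrite -leNgt /cover_sum big_ord_recl/= big_mkcond/=.
rewrite big_seq1 tree_root J0 /= (weight0 wpsi) lerDl; apply: sumr_ge0 => m _.
rewrite big_seq_cond; apply: sumr_ge0 => v; rewrite mem_words.
by case/andP => /eqP sv /andP[wv _]; exact/ltW/(weight_gt0 wpsi).
Qed.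

(** Sorting words of level n by a prefix in the cover bounds S_n by the sum of c_m S_(n-m), where
    c_m is the weight of the cover at level m. As the c_m add up to less than 1, some shifted sum is
    at least S_n; c_0 vanishes because the empty word has weight 1. *)
Lemma level_sum_covered w l n : covered w l 1 -> (l <= n)%N ->
  exists m, [/\ (0 < m)%N, (m <= l)%N & level_sum n w <= level_sum (n - m) (Xin m w)].
Proof.
move=> [J Jc Js] ln; apply: contrapT => nm.
have J0 := cover_sum_nil Js.
have lt m : (0 < m)%N -> (m <= l)%N -> level_sum (n - m) (Xin m w) < level_sum n w.
  by move=> m0 ml; rewrite ltNge; apply/negP => h; apply: nm; exists m.
pose c m := \sum_(u <- words _ (level w m) | isSome (tree w u) && J u) psi m w u.
have c0 m : 0 <= c m.
  rewrite /c big_seq_cond; apply: sumr_ge0 => v; rewrite mem_words.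
  by case/andP => /eqP sv /andP[wv _]; exact/ltW/(weight_gt0 wpsi).
suff : level_sum n w <= (\sum_(m < l.+1) c m) * level_sum n w.
  by rewrite -[leLHS]mul1r ler_pM2r ?level_sum_gt0// leNgt Js.
apply: (@le_trans _ _ (\sum_(m < l.+1) \sum_(u <- words _ (level w n) |
    isSome (tree w u) && J (take (level w m) u)) psi n w u)).
  under eq_bigr do rewrite big_mkcond/=.
  rewrite exchange_big/= /level_sum big_mkcond/= big_seq [leRHS]big_seq.
  apply: ler_sum => u; rewrite mem_words => /eqP su.
  have p0 : isSome (tree w u) -> 0 <= psi n w u by move=> wu; exact/ltW/(weight_gt0 wpsi).
  case: ifPn => wu; last by rewrite sumr_ge0// => i _; case: ifP => // /andP[].
  have [||m ml Jm] := Jc (take (level w l) u).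
  - by rewrite size_takel// su level_le.
  - by apply: (@tree_prefix _ _ _ _ _ _ (drop (level w l) u)); rewrite cat_take_drop.
  have ml' : (m < l.+1)%N by [].
  rewrite (bigD1 (Ordinal ml'))//= -{1}(minn_idPl (level_le w ml)) take_min Jm.
  by rewrite lerDl; apply: sumr_ge0 => i _; case: ifP => // _; exact: p0.
rewrite mulr_suml; apply: ler_sum => m _; have ml : (m <= l)%N by rewrite -ltnS.
apply: (le_trans (level_sum_split _ J (leq_trans ml ln))).
rewrite -/(c m); have [m0|m0] := posnP m; last by rewrite ler_wpM2l// ltW// lt.
have -> : c m = 0; last by rewrite !mul0r.
by rewrite m0 /c big_mkcond/= big_seq1 (negbTE J0) andbF.
Qed.

(** Fix a word [u] up to the first neck and keep the cover words that extend it, with [u] removed;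
    their weights grow at most by a factor depending on [u] alone. *)
Lemma null_covers_Xi w : null_covers w -> null_covers (Xi w).
Proof.
move=> Zw eps eps0; have [u [su wu]] := tree_word w (level w 1).
have [c c0 tail] := weight_tail wpsi su wu.
(* The bound 1 keeps the empty word out of the cover, and [eps / c] absorbs the factor lost by
   removing [u]. *)
have e0 : 0 < Num.min 1 (eps / c) by rewrite lt_min ltr01 divr_gt0.
have [l [J Jc Js]] := Zw _ e0.
have J0 : ~~ J [::] by apply: (cover_sum_nil (lt_le_trans Js _)); rewrite ge_min lexx.
case: l Jc Js => [|l] Jc Js.
  have [m ml] := Jc [::] erefl (tree_root w); rewrite /= => Jm.
  by rewrite Jm in J0.
exists l; exists (fun v => J (u ++ v)).
  move=> v; rewrite (shift_treeE v su wu) level_Xi => sv wuv.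
  have suv : size (u ++ v) = level w l.+1.
    by rewrite size_cat su sv subnKC// level_le.
  have [[|m] ml Jm] := Jc _ suv wuv; first by rewrite take0 (negbTE J0) in Jm.
  exists m => //; rewrite level_Xi; congr (J _): Jm.
  have h : (level w 1 <= level w m.+1)%N by rewrite level_le.
  rewrite take_cat su ltnNge h/= //.
have -> : eps = c * (eps / c) by rewrite mulrCA divff ?mulr1// gt_eqF.
apply: (@le_lt_trans _ _ (c * cover_sum w l.+1 J)); last first.
  by rewrite ltr_pM2l// (lt_le_trans Js)// ge_min lexx orbT.
rewrite /cover_sum [in leRHS]big_ord_recl mulrDr; apply: ler_wpDl.
  apply: mulr_ge0; first exact: ltW.
  rewrite big_seq_cond; apply: sumr_ge0 => v; rewrite mem_words.
  by case/andP => /eqP sv /andP[wv _]; exact/ltW/(weight_gt0 wpsi).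
rewrite mulr_sumr; apply: ler_sum => m _; rewrite lift0.
have -> : level w m.+1 = (level w 1 + level (Xi w) m)%N by rewrite -(level_split 1).
rewrite [in leRHS]big_mkcond/= sum_words_add.
rewrite (bigD1_seq u)/= ?words_uniq ?mem_words ?su//.
rewrite mulrDr; apply: ler_wpDr.
  apply: mulr_ge0; first exact: ltW.
  rewrite big_seq_cond; apply: sumr_ge0 => x; rewrite mem_words => /andP[/eqP sx _].
  rewrite big_seq; apply: sumr_ge0 => v; rewrite mem_words => /eqP sv.
  case: ifP => // /andP[wxv _]; apply/ltW/(weight_gt0 wpsi) => //.
  by rewrite size_cat sx sv -(level_split 1).
rewrite mulr_sumr big_mkcond/= big_seq [leRHS]big_seq; apply: ler_sum => v.
rewrite mem_words => /eqP sv; rewrite -[shift_tree w v]/(tree (Xi w) v) (shift_treeE v su wu).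
by case: ifP => [/andP[wuv _]|]; rewrite ?mulr0// tail.
Qed.

Hypothesis wt_at_most1 : forall w u, isSome (tree w u) -> wt s w u <= 1.

(** There are at most M^(N_1) words up to the first neck, each of weight at most 1. *)
Lemma level_sum_step n w :
  level_sum n.+1 w <= (maxmaps F)%:R ^+ level w 1 * level_sum n (Xi w).
Proof.
have h : level_sum n.+1 w <= level_sum 1 w * level_sum n (Xi w).
  have := level_sum_split w predT (ltn0Sn n); rewrite subSS subn0 /level_sum.
  by under eq_bigl do rewrite andbT; under [X in X * _]eq_bigl do rewrite andbT.
apply: (le_trans h); rewrite ler_wpM2r ?(ltW (level_sum_gt0 _ _))// /level_sum.
rewrite -natrX -[X in (X ^ _)%N]card_ord -size_words -sum1_size natr_sum.
rewrite big_mkcond/= big_seq [leRHS]big_seq; apply: ler_sum => u.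
rewrite mem_words => /eqP su; case: ifP => // wu.
exact: le_trans (@weight_le_wt _ _ wpsi 1%N w u su wu) (wt_at_most1 wu).
Qed.

(* Total length of the neck gaps, below level [n], which a greedy use of covers
   with at most [l] levels does not control: those where there is no such cover,
   and the last [l] ones. *)
Definition bad_length l n w : nat :=
  (\sum_(0 <= j < n)
     (~~ `[< covered (Xin j w) l 1 >] + (n <= j + l)) * level (Xin j w) 1)%N.

Lemma bad_length_Xin l n m w : (m <= n)%N -> bad_length l (n - m) (Xin m w) =
  (\sum_(m <= j < n)
     (~~ `[< covered (Xin j w) l 1 >] + (n <= j + l)) * level (Xin j w) 1)%N.
Proof.
move=> mn; rewrite -[in RHS](add0n m) big_addn /bad_length; apply: eq_bigr => j _.
by rewrite -XinD [(m + j)%N]addnC addnAC leq_subLR [(m + _)%N]addnC.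
Qed.

(** Strong induction: where a short cover exists and fits below level n, [level_sum_covered] skips
    some levels at no cost; otherwise one level is crossed by [level_sum_step], at the cost of a gap
    counted in [bad_length]. *)
Lemma level_sum_le l n w : level_sum n w <= (maxmaps F)%:R ^+ bad_length l n w.
Proof.
have M1 : 1 <= (maxmaps F)%:R :> R by rewrite ler1n maxmaps_gt0.
elim/ltn_ind: n w => -[|n] ih w.
  by rewrite /level_sum big_mkcond/= big_seq1 tree_root (weight0 wpsi) exprn_ege1.
have split m : (m <= n.+1)%N -> bad_length l n.+1 w =
   (\sum_(0 <= j < m) (~~ `[< covered (Xin j w) l 1 >] + (n.+1 <= j + l)) * level (Xin j w) 1
   + bad_length l (n.+1 - m) (Xin m w))%N.
  by move=> mn; rewrite bad_length_Xin// /bad_length (big_cat_nat (n := m)).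
have [cw|ncw] := pselect (covered w l 1 /\ (l <= n.+1)%N).
  have [m [m0 ml h]] := level_sum_covered cw.1 cw.2.
  apply: (le_trans h); apply: (le_trans (ih _ _ _)); first by rewrite ltn_subrL m0.
  apply: ler_weXn2l => //; rewrite (split m) ?leq_addl// (leq_trans ml)//.
  exact: cw.2.
apply: (le_trans (level_sum_step _ _)).
apply: (@le_trans _ _ ((maxmaps F)%:R ^+ level w 1 * (maxmaps F)%:R ^+ bad_length l n (Xi w))).
  by rewrite ler_wpM2l ?exprn_ge0//; exact: ih.
rewrite -exprD; apply: ler_weXn2l => //; rewrite (split 1%N)// subSS subn0 big_nat1.
rewrite leq_add2r -{1}[level w 1]mul1n leq_mul2r; apply/orP; right.
rewrite add0n; case: (boolP `[< covered (Xin 0 w) l 1 >]) => //= /asboolP cw.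
by rewrite lt0b leqNgt; apply/negP => ln; apply: ncw; split => //; exact: ltnW.
Qed.

End covers.

(** * Blocks of necks *)

Section subsampling.
Context (R : realType) (d : nat) (L : topologicalType) (F : affineFamily R d L).
Implicit Types (w : codeTree F) (u v : seq 'I_(maxmaps F)).

Lemma level_ltn w m n : (m < n)%N -> (level w m < level w n)%N.
Proof. by move=> mn; exact: leq_trans (level_lt w m) (level_le w mn). Qed.

Section subtree.
Variables (k : nat) (w : codeTree F).

Definition subneck m : nat := level w (k.+1 * m.+1).

Lemma subneck_gt0 : (0 < subneck 0)%N.
Proof. by rewrite -[0%N]/(level w 0) level_ltn. Qed.

Lemma subneck_incr m : (subneck m < subneck m.+1)%N.
Proof. by apply: level_ltn; rewrite ltn_pmul2l. Qed.

Lemma subneckP m u u' v : size u = subneck m -> size u' = subneck m ->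
  isSome (tree w (u ++ v)) -> isSome (tree w u') ->
  isSome (tree w (u' ++ v)) /\ tree w (u ++ v) = tree w (u' ++ v).
Proof. exact: (@neckP _ _ _ _ w (m + k * m.+1)). Qed.

(** The tree is unchanged and every (k+1)-st neck is kept; the successor makes the block length
    positive. *)
Definition subtree : codeTree F :=
  CodeTree (tree_root w) (@tree_step _ _ _ _ w) subneck_gt0 subneck_incr subneckP.

Lemma level_subtree m : level subtree m = level w (k.+1 * m).
Proof. by case: m => //; rewrite muln0. Qed.

End subtree.

Lemma Xi_subtree k w : Xi (subtree k w) = subtree k (Xin k.+1 w).
Proof.
apply: codeTree_eq.
  have [u [su wu]] := tree_word w (level w k.+1).
  apply/funext => v.
  have su' : size u = neck (subtree k w) 0 by rewrite su /= /subneck muln1.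
  transitivity (tree w (u ++ v)); last exact/esym/tree_Xin.
  exact: (@shift_treeE _ _ _ _ (subtree k w) u v su' wu).
apply/funext => m; rewrite -[LHS]/(subneck k w m.+1 - subneck k w 0)%N.
rewrite -[RHS]/(subneck k (Xin k.+1 w) m) /subneck level_Xin muln1.
by rewrite [(_ * m.+2)%N]mulnS.
Qed.

Lemma Xin_subtree k n w : Xin n (subtree k w) = subtree k (Xin (k.+1 * n) w).
Proof.
elim: n w => [|n ih] w; first by rewrite muln0.
by rewrite XinS Xi_subtree ih -XinD mulnS.
Qed.

End subsampling.

(** * The weights below and above the dimension *)

Section concrete_weights.
Context (R : realType) (d : nat) (L : topologicalType) (F : affineFamily R d L).
Hypothesis d_gt0 : (0 < d)%N.
Implicit Types (w : codeTree F) (u v : seq 'I_(maxmaps F)) (s : R).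

Lemma wt_nil s w : 0 <= s -> wt s w [::] = 1.
Proof. by move=> s0; exact: Phi_1. Qed.

Lemma wt_local s w w' m u : agree m w w' -> (size u <= level w m)%N ->
  wt s w' u = wt s w u.
Proof.
move=> [_ ag] su; rewrite /wt; congr (Phi s _); apply: word_map_eq => v vu.
by apply: ag; rewrite (leq_trans (ltnW vu)).
Qed.

Lemma wt_weight s : 0 <= s -> s < d%:R -> weight s (fun _ w u => wt (F := F) s w u).
Proof.
move=> s0 sd; split.
- by move=> w; exact: wt_nil.
- by move=> m w u _ wu; exact: wt_gt0.
- by [].
- by move=> m n w u v su _; exact: wt_submul.
- move=> w u su wu; have [c c0 h] := wt_tail d_gt0 s0 sd su wu.
  by exists c => // n v _; exact: h.
- by move=> m w w' u ag su; apply: (wt_local _ ag); rewrite su.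
Qed.

(* For [s >= d] the singular value function is supermultiplicative, and this
   multiplicative minorant of [wt s] takes its place. *)
Fixpoint block_wt s m w u : R :=
  if m is m'.+1 then
    wt s w (take (level w 1) u) * block_wt s m' (Xi w) (drop (level w 1) u)
  else 1.

Lemma block_wtS s m w u : block_wt s m.+1 w u =
  wt s w (take (level w 1) u) * block_wt s m (Xi w) (drop (level w 1) u).
Proof. by []. Qed.

Lemma block_wt_mul s m n w u v : size u = level w m ->
  block_wt s (m + n) w (u ++ v) = block_wt s m w u * block_wt s n (Xin m w) v.
Proof.
elim: m w u => [|m ih] w u; first by move=> /size0nil ->; rewrite mul1r.
move=> su; have le1 : (level w 1 <= size u)%N by rewrite su level_le.
rewrite addSn !block_wtS XinS -mulrA.
rewrite takel_cat// drop_cat.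
move: le1; rewrite leq_eqVlt => /predU1P[eu|->].
  rewrite -eu ltnn subnn drop0 drop_oversize ?eu//.
  rewrite -ih//; rewrite level_Xi -su -eu subnn//.
by rewrite ih// size_drop su level_Xi.
Qed.

(** Supermultiplicativity of [wt] puts the product over blocks below [wt]. The product is exactly
    multiplicative at necks, so a removed first block costs the inverse of its weight. *)
Lemma block_weight s : d%:R <= s -> weight s (block_wt s).
Proof.
move=> ds; have s0 := le_trans (ler0n R d) ds.
have split m w u : size u = level w m.+1 -> isSome (tree w u) ->
  [/\ size (take (level w 1) u) = level w 1, size (drop (level w 1) u) = level (Xi w) m,
    isSome (tree w (take (level w 1) u)) & isSome (tree (Xi w) (drop (level w 1) u))].
  move=> su wu; have le1 : (level w 1 <= size u)%N by rewrite su level_le.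
  have st : size (take (level w 1) u) = level w 1 by rewrite size_takel.
  have wt1 : isSome (tree w (take (level w 1) u)).
    by apply: (@tree_prefix _ _ _ _ _ _ (drop (level w 1) u)); rewrite cat_take_drop.
  by rewrite (shift_treeE _ st wt1) cat_take_drop size_drop su level_Xi.
split.
- by [].
- elim=> [|m ih] w u su wu; first by rewrite ltr01.
  have [s1 s2 w1 w2] := split _ _ _ su wu.
  by rewrite block_wtS mulr_gt0 ?wt_gt0 ?ih.
- elim=> [|m ih] w u su wu; first by rewrite (size0nil su) wt_nil.
  have [s1 s2 w1 w2] := split _ _ _ su wu.
  rewrite block_wtS.
  have := @wt_supermul _ _ _ _ d_gt0 s w 1 (take (level w 1) u) (drop (level w 1) u) ds s1.
  rewrite cat_take_drop => /(_ wu); apply: le_trans.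
  by rewrite ler_wpM2l ?ih// ltW// wt_gt0.
- by move=> m n w u v su _ _; rewrite block_wt_mul.
- move=> w u su wu; exists (wt s w u)^-1; first by rewrite invr_gt0 wt_gt0.
  move=> n v _ _; rewrite block_wtS take_size_cat// drop_size_cat//.
  by rewrite mulKf// gt_eqF// wt_gt0.
- elim=> [//|m ih] w w' u ag su; rewrite !block_wtS; have -> : level w' 1 = level w 1 by have [->] := ag.
  have [le1 le2] : (level w 1 <= size u)%N /\ (level w 1 <= level w m.+1)%N by rewrite su level_le.
  rewrite (wt_local _ ag) ?size_takel// (ih (Xi w) (Xi w'))//.
    exact: agree_Xi.
  by rewrite size_drop su level_Xi.
Qed.

Definition length_sum s w n : R :=
  \sum_(u <- words _ n | isSome (tree w u)) wt s w u.

(** The choices in successive gaps are independent, so the sum of a product over gaps is the product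
    of the sums. *)
Lemma level_sum_block s n w : level_sum (block_wt s) n w =
  \prod_(i < n) length_sum s (Xin i w) (level (Xin i w) 1).
Proof.
elim: n w => [|n ih] w.
  by rewrite big_ord0 /level_sum big_mkcond/= big_seq1 tree_root.
rewrite big_ord_recl; under eq_bigr do rewrite lift0 XinS.
rewrite -ih /level_sum /length_sum (level_split 1 n) big_mkcond sum_words_add.
rewrite mulr_suml [in RHS]big_mkcond big_seq [in RHS]big_seq; apply: eq_bigr => u.
rewrite mem_words => /eqP su; case: ifPn => wu; last first.
  rewrite big1// => v _; case: ifPn => // /tree_prefix wu'.
  by rewrite wu' in wu.
rewrite mulr_sumr [in RHS]big_mkcond; apply: eq_bigr => v _.
rewrite (@tree_Xin_cat _ _ _ _ 1 w u v su) wu andTb -[Xin 1 w]/(Xi w); case: ifPn => // wv.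
by rewrite block_wtS take_size_cat// drop_size_cat.
Qed.

End concrete_weights.

(** * Covers of the boundary *)

Section affinity_covers.
Context (R : realType) (d : nat) (L : topologicalType) (F : affineFamily R d L).
Implicit Types (w : codeTree F) (u v : seq 'I_(maxmaps F)) (s : R).

(* Koenig's lemma, that is, the compactness of the boundary. *)
Lemma boundary_cover_bounded w (J : set (seq 'I_(maxmaps F))) :
  boundary w `<=` \bigcup_(u in J) word_cylinder w u ->
  exists n, forall u, size u = n -> isSome (tree w u) ->
    exists2 i, (i <= n)%N & J (take i u).
Proof.
(* A word is free when it has no prefix in [J], and live when it has free extensions of every
   length. Finiteness of the alphabet extends a live word by a letter; if the claim fails, the empty
   word is live, and following live letters gives a boundary point outside the cover. *)
move=> bJ; pose free u := isSome (tree w u) /\ forall i, (i <= size u)%N -> ~ J (take i u).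
have free_prefix u v : free (u ++ v) -> free u.
  move=> [wuv h]; split; first exact: tree_prefix wuv.
  move=> i iu; have := h i; rewrite takel_cat//; apply.
  by rewrite (leq_trans iu)// size_cat leq_addr.
pose live u := forall n, exists2 v, size v = n & free (u ++ v).
have liveP u : live u -> exists a, live (rcons u a).
  move=> lu; apply: contrapT => nl.
  have /choice[N NP] : forall a, exists n, forall v, size v = n -> ~ free (rcons u a ++ v).
    move=> a; apply: contrapT => h; apply: nl; exists a => n.
    apply: contrapT => h'; apply: h; exists n => v sv fv; apply: h'; by exists v.
  (* The successor leaves room for the first letter [a], after which at least [N a] letters
     remain. *)
  have [[//|a v] /= [sv] fv] := lu (\max_a N a).+1.
  apply: (NP a (take (N a) v)); first by rewrite size_takel// sv leq_bigmax.
  apply: (free_prefix _ (drop (N a) v)).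
  by rewrite -catA cat_take_drop cat_rcons.
apply: contrapT => nb.
have live0 : live [::].
  move=> n; apply: contrapT => h; apply: nb; exists n => u su wu.
  apply: contrapT => h'; apply: h; exists u => //; split => // i iu Ji.
  by apply: h'; exists i; rewrite -?su.
have a0 : 'I_(maxmaps F) := Ordinal (maxmaps_gt0 F).
pose next u := xget a0 [set a | live (rcons u a)].
pose U := fix U n := if n is n'.+1 then rcons (U n') (next (U n')) else [::].
have liveU n : live (U n).
  elim: n => //= n ih; have [a la] := liveP _ ih.
  exact: (@xgetPex _ a0 [set a | live (rcons (U n) a)] (ex_intro _ a la)).
have freeU n : free (U n).
  by have [v /size0nil ->] := liveU n 0%N; rewrite cats0.
pose x n := next (U n).
have xU n : mkseq x n = U n.
  by elim: n => // n ih; rewrite mkseqS ih.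
have bx : boundary w x by move=> n; rewrite xU; have [] := freeU n.
have [u Ju [_ xu]] := bJ x bx.
have [_ /(_ _ (leqnn _))] := freeU (size u).
by rewrite take_size -xU xu.
Qed.

Lemma affinity_premeasure_nondecreasing w s (E : set (nat -> 'I_(maxmaps F))) :
  nondecreasing_seq (fun j => affinity_premeasure w s j E).
Proof.
move=> i j ij; apply: ereal_inf_le_tmp => _ [J [a b c] <-]; exists J => //.
by split => // u Ju; exact: leq_trans (c u Ju).
Qed.

Lemma affinity_premeasure_le w s j (E : set (nat -> 'I_(maxmaps F))) :
  (affinity_premeasure w s j E <= affinity_measure w s E)%E.
Proof.
have nd : nondecreasing_seq (fun j => affinity_premeasure w s j E).
  exact: affinity_premeasure_nondecreasing.
rewrite /affinity_measure (cvg_lim _ (ereal_nondecreasing_cvgn nd))//.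
by apply: ereal_sup_ubound; exists j.
Qed.

Lemma sum_words_le_esum w s (J : set (seq 'I_(maxmaps F))) n : 0 <= s ->
  (forall u, J u -> isSome (tree w u)) ->
  ((\sum_(i < n) \sum_(u <- words _ i | isSome (tree w u) && (u \in J)) wt s w u)%:E
    <= \esum_(u in J) (wt s w u)%:E)%E.
Proof.
move=> s0 Jw; pose r := [seq u <- flatten [seq words 'I_(maxmaps F) i | i <- iota 0 n] | u \in J].
have ur : uniq r.
  apply: filter_uniq; elim: n {r} => // n ih.
  rewrite -addn1 iotaD map_cat flatten_cat cat_uniq ih/= cats0 words_uniq andbT.
  apply/hasPn => u; rewrite mem_words => /eqP su; apply/negP => /flattenP[_ /mapP[i + ->]].
  by rewrite mem_iota mem_words su => /andP[_ iln] /eqP E; rewrite E ltnn in iln.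
apply: esum_ge; exists [set` r].
  by split => [|u]; [exact: finite_seq|rewrite /= mem_filter => /andP[/set_mem]].
rewrite -fsbig_seq// sumEFin lee_fin /r big_filter.
rewrite big_flatten/= big_map -(big_mkord xpredT (fun i =>
  \sum_(u <- words _ i | isSome (tree w u) && (u \in J)) wt s w u)).
rewrite /index_iota subn0; apply: ler_sum => i _; rewrite le_eqVlt; apply/orP; left; apply/eqP.
by apply: eq_bigl => u; case: (boolP (u \in J)) => [/set_mem/Jw ->|]; rewrite ?andbF.
Qed.

End affinity_covers.

(** * From vanishing affinity measure to covers at necks *)

Section null_covers_of_measure_zero.
Context (R : realType) (d : nat) (L : topologicalType) (F : affineFamily R d L).
Hypothesis d_gt0 : (0 < d)%N.
Variables lo hi : R.
Hypotheses (lo_gt0 : 0 < lo) (hi_gt0 : 0 < hi) (hi_lt1 : hi < 1).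
Hypothesis bounds : forall l (i : 'I_(nmaps (F l))) j, (j < d)%N ->
  lo <= sigma (linear_part i) j <= hi.
Implicit Types (w : codeTree F) (u v : seq 'I_(maxmaps F)) (s : R).

(** [level (Xin m w) 1] is the gap between N_m and N_(m+1); the condition says that it is o(m), with
    1/p in the role of epsilon. *)
Definition sublinear_gaps w := forall p, exists m0, forall m, (m0 <= m)%N ->
  (level (Xin m w) 1 * p <= m)%N.

Lemma geometric_lt (q x : R) : 0 <= q -> q < 1 -> 0 < x -> exists p, q ^+ p <= x.
Proof.
move=> q0 q1 x0.
have /cvgr0_norm_le/(_ x x0) [p _ h] : (fun n => q ^+ n) @ \oo --> (0 : R).
  by apply: cvg_expr; rewrite ger0_norm.
by exists p; have := h p (leqnn p); rewrite /= ger0_norm// exprn_ge0.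
Qed.

(** There are at most M^g extensions, none heavier than [u], and passing from s' to s gains a factor
    exponentially small in the length of [u]. *)
Lemma wt_extend s s' w u g : 0 <= s' -> s' < s -> isSome (tree w u) ->
  (maxmaps F)%:R ^+ g * (hi `^ (s - s')) ^+ size u <= 1 ->
  \sum_(v <- words _ g | isSome (tree w (u ++ v))) wt s w (u ++ v) <= wt s' w u.
Proof.
move=> s'0 s's wu hg; have s0 := le_trans s'0 (ltW s's).
apply: (@le_trans _ _ (\sum_(v <- words 'I_(maxmaps F) g) wt s w u)).
  rewrite [leLHS]big_mkcond; apply: ler_sum => v _; case: ifPn => wuv.
    exact: (wt_prefix d_gt0 hi_lt1 bounds wuv s0).
  by rewrite ltW// wt_gt0.
rewrite big_const_seq count_predT size_words card_ord iter_addr addr0.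
rewrite -mulr_natl natrX.
apply: (le_trans (ler_wpM2l _ (wt_decr d_gt0 hi_gt0 bounds wu s'0 (ltW s's)))).
  by rewrite exprn_ge0.
by rewrite mulrA ler_piMl// ltW// wt_gt0.
Qed.

(** Take a cover by long words of small weight at s', of which by compactness those of bounded
    length suffice, and extend them to the next neck. The gaps being sublinear, the number of
    extensions is outweighed by the gain from s' to s. *)
Lemma null_covers_affinity s s' psi w : weight s psi -> 0 <= s' -> s' < s ->
  sublinear_gaps w -> affinity_measure w s' (boundary w) = 0%E -> null_covers psi w.
Proof.
move=> wpsi s'0 s's gaps aff eps eps0; have s0 := le_trans s'0 (ltW s's).
pose q := hi `^ (s - s').
have q0 : 0 <= q by exact: powR_ge0.
have q1 : q < 1.
  have ss : 0 < s - s' by rewrite subr_gt0.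
  have := gt0_ltr_powR ss _ _ hi_lt1; rewrite powR1; apply; rewrite nnegrE//.
  exact: ltW.
have M0 : 0 < (maxmaps F)%:R :> R by rewrite ltr0n maxmaps_gt0.
(* With M q^p at most 1, extending by g letters is free for words of length at least g p. *)
have [p qp] : exists p, q ^+ p <= (maxmaps F)%:R^-1 by apply: geometric_lt; rewrite ?invr_gt0.
have [m0 gapm] := gaps p.
have : (affinity_premeasure w s' (level w m0).+1 (boundary w) < eps%:E)%E.
  by apply: (le_lt_trans (affinity_premeasure_le _ _ _ _)); rewrite aff lte_fin.
move=> /ereal_inf_lt[_ [J [Jw Jb Jj] <-] Js].
have [n Jn] := boundary_cover_bounded Jb.
pose J' u := `[< exists m i,
  [/\ size u = level w m.+1, (level w m < i)%N, (i <= size u)%N & J (take i u)] >].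
(* Since n is at most N_n, every word of level n already has its prefix of length n, hence a prefix
   in [J]. *)
exists n; exists J'.
  move=> u su wu.
  have nn := leq_level w n.
  have [||i iln Ji] := Jn (take n u); first by rewrite size_takel// su.
    by apply: (@tree_prefix _ _ _ _ _ _ (drop n u)); rewrite cat_take_drop.
  rewrite take_takel// in Ji.
  have i0 : (0 < i)%N.
    have := Jj _ Ji; rewrite size_takel ?su ?(leq_trans iln)//.
    exact: leq_ltn_trans.
  have ex : exists m, (i <= level w m)%N by exists n; exact: leq_trans iln nn.
  (* Level [m.+1] is the first neck at or beyond the end of the cover word. *)
  case: (ex_minnP ex) => -[|m]; first by rewrite /= leqNgt i0.
  move=> im mmin; have mn : (m.+1 <= n)%N by apply: mmin; exact: leq_trans iln nn.
  have sm : size (take (level w m.+1) u) = level w m.+1.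
    by rewrite size_takel// su level_le.
  exists m.+1 => //; apply/asboolP; exists m, i; split => //.
  - by rewrite ltnNge; apply/negP => /mmin; rewrite ltnn.
  - by rewrite sm.
  - by rewrite take_takel.
pose b i := \sum_(v <- words _ i | isSome (tree w v) && (v \in J)) wt s' w v.
have b0 i : 0 <= b i by apply: sumr_ge0 => v /andP[wv _]; rewrite ltW// wt_gt0.
(* Level m is charged to the words of [J] that end in the gap just before it; [i.+1] runs over the
   lengths above N_(m-1) up to and including N_m, and the range is empty for m = 0. *)
suff h m : \sum_(u <- words _ (level w m) | isSome (tree w u) && J' u) psi m w u <=
    \sum_(level w m.-1 <= i < level w m) b i.+1.
  rewrite -lte_fin.
  apply: (@le_lt_trans _ _ (\sum_(i < (level w n).+1) b i)%:E); last first.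
    by apply: le_lt_trans Js; exact: sum_words_le_esum.
  rewrite lee_fin.
  apply: (@le_trans _ _ (\sum_(m < n.+1) \sum_(level w m.-1 <= i < level w m) b i.+1)).
    by apply: ler_sum => m _; exact: h.
  rewrite big_ord_recl big_geq// add0r [leRHS]big_ord_recl ler_wpDl//.
  under [leRHS]eq_bigr do rewrite lift0.
  rewrite -(big_mkord xpredT (fun i => b i.+1)).
  rewrite le_eqVlt; apply/orP; left; apply/eqP.
  elim: (n) => [|n' ih]; first by rewrite big_ord0 big_geq.
  rewrite big_ord_recr/= ih -big_cat_nat//; exact/ltnW/level_lt.
case: m => [|m].
  rewrite big_geq// big_mkcond big_seq1; case: ifP => // /andP[_ /asboolP[m [i [s1 _ _ _]]]].
  by have := level_lt w m; rewrite -s1.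
rewrite big_mkcond big_seq.
apply: (@le_trans _ _ (\sum_(u <- words _ (level w m.+1)) \sum_(level w m <= i < level w m.+1)
    if isSome (tree w u) && (take i.+1 u \in J) then wt s w u else 0)).
  rewrite [leRHS]big_seq; apply: ler_sum => u; rewrite mem_words => /eqP su.
  have pos i : 0 <= if isSome (tree w u) && (take i.+1 u \in J) then wt s w u else 0.
    by case: ifP => // /andP[wu _]; rewrite ltW// wt_gt0.
  case: ifPn => [/andP[wu /asboolP[m' [i [s1 s2 s3 Ji]]]]|_]; last first.
    by apply: sumr_ge0 => i _; exact: pos.
  have E : m' = m.
    apply/eqP; rewrite eqn_leq; apply/andP; split; rewrite leqNgt; apply/negP => mm.
      by have := level_ltn w (mm : (m.+1 < m'.+1)%N); rewrite -s1 su ltnn.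
    by have := level_ltn w (mm : (m'.+1 < m.+1)%N); rewrite -s1 su ltnn.
  rewrite {}E in s1 s2 *; case: i s2 s3 Ji => // i s2 s3 Ji.
  rewrite (bigD1_seq i); first last.
  - exact: iota_uniq.
  - by rewrite mem_index_iota -su; apply/andP.
  rewrite wu (mem_set Ji)/=; apply: ler_wpDr; last first.
    exact: (@weight_le_wt _ _ _ _ _ _ wpsi m.+1 w u su wu).
  by apply: sumr_ge0 => j _; case: ifP => // _; rewrite ltW// wt_gt0.
rewrite exchange_big/= big_seq [leRHS]big_seq; apply: ler_sum => i.
rewrite mem_index_iota => /andP[mi im].
rewrite -[X in words _ X](subnKC im) sum_words_add /b [leRHS]big_mkcond big_seq [leRHS]big_seq.
apply: ler_sum => v; rewrite mem_words => /eqP sv.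
under eq_bigr do rewrite take_size_cat//.
case: (boolP (v \in J)) => vJ; last first.
  by rewrite andbF big1// => x _; rewrite andbF.
rewrite andbT; under eq_bigr do rewrite andbT.
have wv : isSome (tree w v) by apply: Jw; exact: set_mem.
rewrite wv -big_mkcond; apply: wt_extend => //; rewrite sv -/q.
set g := (level w m.+1 - i.+1)%N.
(* Words of [J] are longer than N_(m0), so the level just before their end has index at least [m0]
   and the gap estimate applies. *)
have gp : (g * p <= i.+1)%N.
  have mm0 : (m0 <= m)%N.
    rewrite leqNgt; apply/negP => mm0.
    have := Jj _ (set_mem vJ); rewrite sv ltnNge => /negP; apply.
    exact: leq_trans im (level_le w mm0).
  apply: (@leq_trans m); last by rewrite (leq_trans (leq_level w m))// ltnW.
  apply: leq_trans (gapm _ mm0); rewrite leq_mul2r; apply/orP; right.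
  by rewrite level_Xin addn1 leq_sub2l// ltnW.
apply: (@le_trans _ _ ((maxmaps F)%:R ^+ g * q ^+ (g * p))).
  by rewrite ler_wpM2l ?exprn_ge0//; apply: ler_wiXn2l => //; exact: ltW.
rewrite mulnC exprM -exprMn; apply: exprn_ile1; first by rewrite mulr_ge0 ?exprn_ge0.
by rewrite -ler_pdivlMl// mulr1.
Qed.

End null_covers_of_measure_zero.

(** * Measurability *)

Section finite_data.
Context (R : realType) (d : nat) (L : topologicalType) (F : affineFamily R d L).
Implicit Types (w : codeTree F) (B : set (codeTree F)).

(** A combinatorial description of the open sets of the space of code trees. *)
Definition finite_data B := forall w, B w -> exists m, forall w', agree m w w' -> B w'.

Lemma tree_cylinder_agree w m w' : tree_cylinder (w, m) w' -> agree m w w'.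
Proof.
move=> [/= a b]; split=> [[|i] im //|u um]; first by apply: a; exact: ltnW.
by apply: b; exact: leq_ltn_trans um (level_lt w m).
Qed.

Lemma agree_tree_cylinder (p : codeTree F * nat) w w' :
  agree p.2.+1 w w' -> tree_cylinder p w -> tree_cylinder p w'.
Proof.
move=> [a b] [c e]; have E i : (i <= p.2)%N -> neck w' i = neck p.1 i.
  by move=> ip; rewrite -c//; exact: (a i.+1 ip).
split=> // u up; rewrite -e//; apply: b; rewrite /= c//; exact: ltnW.
Qed.

Lemma finite_data_open B : finite_data B -> open B.
Proof.
move=> fB; exists [set C | exists2 p : codeTree F * nat, tree_cylinder p = C & tree_cylinder p `<=` B].
  move=> _ [p <- _]; exists (fset1 p); last by rewrite set_fset1 bigcap_set1.
  by move=> q _; apply/mem_set.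
apply/seteqP; split=> [w [_ [p <- pB]]|w Bw]; first exact: pB.
have [m mB] := fB w Bw; exists (tree_cylinder (w, m)) => //.
by exists (w, m) => // w' /tree_cylinder_agree/mB.
Qed.

Lemma open_finite_data B : open B -> finite_data B.
Proof.
move=> [I Irp <-] w [C IC Cw]; have [E _ CE] := Irp C IC.
have {}CE : \bigcap_(p in [set` E]) @tree_cylinder R d L F p = C by exact: CE.
have {}Cw : C w by exact: Cw.
exists (\max_(p <- enum_fset E) p.2.+1) => w' ag; exists C => //.
suff : C w' by []; rewrite -CE => p pE; apply: (@agree_tree_cylinder _ w).
  by apply: agree_le ag; rewrite (big_rem p)//= leq_maxl.
by move: Cw; rewrite -CE; exact.
Qed.

Lemma finite_data_measurable B : finite_data B ->
  measurable (B : set (borelCodeTree F)).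
Proof. by move=> fB; apply: sub_sigma_algebra; exact: finite_data_open. Qed.

Lemma finite_data_Xin k B : finite_data B -> finite_data (Xin k @^-1` B).
Proof.
move=> fB w /fB[m mB]; exists (k + m)%N => w' ag; apply: mB; exact: agree_Xin.
Qed.

(** This is continuity into a discrete space, which gives measurability for every sigma-algebra on
    the target. *)
Definition locally_determined (T : Type) (f : codeTree F -> T) :=
  forall w, exists m, forall w', agree m w w' -> f w' = f w.

Lemma locally_determined_preimage (T : Type) (f : codeTree F -> T) (A : set T) :
  locally_determined f -> finite_data (f @^-1` A).
Proof.
by move=> lf w Aw; have [m mf] := lf w; exists m => w' /mf; rewrite /preimage/= => ->.
Qed.

Lemma locally_determined_measurable (e : measure_display) (T : measurableType e)
  (f : borelCodeTree F -> T) :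
  locally_determined f -> measurable_fun setT f.
Proof.
move=> lf _ A _; rewrite setTI.
exact: (@finite_data_measurable (f @^-1` A) (locally_determined_preimage lf)).
Qed.

Lemma measurable_Xin k :
  measurable_fun setT (Xin k : borelCodeTree F -> borelCodeTree F).
Proof.
apply: (@measurability _ _ (borelCodeTree F) (borelCodeTree F) setT (Xin k)
  (@open (codeTree F))) => // _ [B oB <-].
rewrite setTI; apply: (@finite_data_measurable (Xin k @^-1` B)).
exact/finite_data_Xin/open_finite_data.
Qed.

Lemma locally_determined_level k : locally_determined (fun w => level w k).
Proof. by move=> w; exists k => w' [h _]; exact: h. Qed.

Lemma locally_determined_length_sum s k :
  locally_determined (fun w => length_sum s w (level w k)).
Proof.
move=> w; exists k => w' ag; have [a b] := ag.
rewrite /length_sum (a k (leqnn k)).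
rewrite [LHS]big_seq_cond [RHS]big_seq_cond.
apply: eq_big => u.
  by rewrite mem_words; case: eqP => //= su; rewrite b// su.
by rewrite mem_words => /andP[/eqP su _]; apply: (wt_local _ ag); rewrite su.
Qed.

Lemma locally_determined_pair (T1 T2 : Type) (f1 : codeTree F -> T1) (f2 : codeTree F -> T2) :
  locally_determined f1 -> locally_determined f2 ->
  locally_determined (fun w => (f1 w, f2 w)).
Proof.
move=> h1 h2 w; have [m1 e1] := h1 w; have [m2 e2] := h2 w.
exists (maxn m1 m2) => w' ag; rewrite e1 ?e2//; apply: agree_le ag.
  exact: leq_maxr.
exact: leq_maxl.
Qed.

Lemma agree_subtree k m w w' : agree (k.+1 * m) w w' ->
  agree m (subtree k w) (subtree k w').
Proof.
move=> [a b]; split => [i im|u]; first by rewrite !level_subtree a// leq_mul2l im orbT.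
by rewrite level_subtree; exact: b.
Qed.

Lemma finite_data_covered s psi k l eps : weight s psi ->
  finite_data [set w | covered psi (subtree k w) l eps].
Proof.
move=> wpsi w /= cw; exists (k.+1 * l)%N => w' /agree_subtree ag.
exact: covered_agree wpsi _ _ _ _ ag cw.
Qed.

Lemma measurable_null_covers s psi k : weight s psi ->
  measurable ([set w | null_covers psi (subtree k w)] : set (borelCodeTree F)).
Proof.
move=> wpsi; have -> : [set w | null_covers psi (subtree k w)] =
    \bigcap_n \bigcup_l [set w | covered psi (subtree k w) l n.+1%:R^-1].
  apply/seteqP; split=> [w Zw n _|w Zw eps eps0].
    have [|l cl] := Zw n.+1%:R^-1; first by rewrite invr_gt0.
    by exists l.
  have [n ne] : exists n : nat, n.+1%:R^-1 <= eps.
    exists (Num.truncn eps^-1); rewrite invf_ple ?posrE//.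
    exact/ltW/truncnS_gt.
  have [l _ [J Jc Js]] := Zw n I; exists l; exists J => //.
  exact: lt_le_trans Js ne.
apply: bigcapT_measurable => n; apply: bigcupT_measurable => l.
by apply: finite_data_measurable; exact: finite_data_covered wpsi.
Qed.

End finite_data.

(** * Means *)

Section expectation.
Context (e : measure_display) (T : measurableType e) (R : realType)
  (P : probability T R).
Implicit Types (f g : T -> R).

Definition nnm f := measurable_fun setT f /\ forall x, 0 <= f x.

Definition mean f : \bar R := (\int[P]_x (f x)%:E)%E.

Lemma nnm_cst c : 0 <= c -> nnm (fun _ => c).
Proof. by move=> c0; split => // ; exact: measurable_cst. Qed.

Lemma nnm_add f g : nnm f -> nnm g -> nnm (fun x => f x + g x).
Proof. by move=> [mf f0] [mg g0]; split=> [|x]; [exact: measurable_funD|rewrite addr_ge0]. Qed.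

Lemma nnm_mul f g : nnm f -> nnm g -> nnm (fun x => f x * g x).
Proof. by move=> [mf f0] [mg g0]; split=> [|x]; [exact: measurable_funM|rewrite mulr_ge0]. Qed.

Lemma nnm_scale c f : 0 <= c -> nnm f -> nnm (fun x => c * f x).
Proof. by move=> c0 nf; apply: nnm_mul => //; exact: nnm_cst. Qed.

Lemma nnm_sum (I : Type) (r : seq I) (h : I -> T -> R) : (forall i, nnm (h i)) ->
  nnm (fun x => \sum_(i <- r) h i x).
Proof.
move=> nh; split=> [|x]; last by apply: sumr_ge0 => i _; have [] := nh i.
by apply: measurable_sum => i; have [] := nh i.
Qed.

Lemma nnm_indic (A : set T) : measurable A -> nnm (\1_A : T -> R).
Proof. by move=> mA; split=> [|x]; [exact: measurable_indic|rewrite indicE]. Qed.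

Lemma mean_add f g : nnm f -> nnm g -> (mean (fun x => f x + g x)%R = mean f + mean g)%E.
Proof.
move=> [mf f0] [mg g0]; rewrite /mean; under eq_integral do rewrite EFinD.
by rewrite ge0_integralD//; try exact/measurable_EFinP; move=> x _; rewrite lee_fin.
Qed.

Lemma mean_scale c f : 0 <= c -> nnm f -> (mean (fun x => c * f x)%R = c%:E * mean f)%E.
Proof.
move=> c0 [mf f0]; rewrite /mean; under eq_integral do rewrite EFinM.
by rewrite ge0_integralZl_EFin//; try exact/measurable_EFinP; move=> x _; rewrite lee_fin.
Qed.

Lemma mean_sum (I : Type) (r : seq I) (h : I -> T -> R) : (forall i, nnm (h i)) ->
  (mean (fun x => \sum_(i <- r) h i x)%R = \sum_(i <- r) mean (h i))%E.
Proof.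
move=> nh; rewrite /mean; under eq_integral do rewrite -sumEFin.
rewrite ge0_integral_sum// => [i|i x _]; last by rewrite lee_fin; have [] := nh i.
by apply/measurable_EFinP; have [] := nh i.
Qed.

Lemma mean_le f g : nnm f -> nnm g -> (forall x, f x <= g x) -> (mean f <= mean g)%E.
Proof.
move=> [mf f0] [mg g0] fg; apply: ge0_le_integral => //.
- by move=> x _; rewrite lee_fin.
- exact/measurable_EFinP.
- exact/measurable_EFinP.
- by move=> x _; rewrite lee_fin.
Qed.

Lemma mean_ge0 f : nnm f -> (0 <= mean f)%E.
Proof. by move=> [_ f0]; apply: integral_ge0 => x _; rewrite lee_fin. Qed.

Lemma mean_indic (A : set T) : measurable A -> mean (\1_A : T -> R) = P A.
Proof. by move=> mA; rewrite /mean integral_indic// setIT. Qed.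

(** The truncated functions vanish eventually at each point and are dominated by [g]. *)
Lemma mean_tail g (delta : R) : nnm g -> (mean g < +oo)%E -> 0 < delta ->
  exists n : nat, (mean (fun x => g x * \1_[set y | n%:R < g y] x)%R <= delta%:E)%E.
Proof.
move=> [mg g0] gfin d0.
have mt n : measurable [set y | n%:R < g y].
  have -> : [set y | n%:R < g y] = g @^-1` `]n%:R, +oo[%classic.
    by apply/seteqP; split => x /=; rewrite in_itv/= andbT.
  by rewrite -[X in measurable X]setTI; exact: mg.
have ig : P.-integrable setT (EFin \o g).
  apply/integrableP; split; first exact/measurable_EFinP.
  by under eq_integral do rewrite /= ger0_norm//.
pose f_ n x := (g x * \1_[set y | n%:R < g y] x)%:E.
have [|||||_ _] := @dominated_convergence _ _ _ P setT measurableT f_ (cst 0%E) (EFin \o g).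
- by move=> n; apply/measurable_EFinP; apply: measurable_funM => //; exact: measurable_indic.
- exact: measurable_cst.
- apply: aeW => x _; apply: cvg_near_cst.
  exists (Num.truncn (g x)).+1 => // n /= gn; rewrite /f_ indicE memNset ?mulr0//=.
  apply/negP; rewrite -leNgt; apply: ltW; apply: lt_le_trans (truncnS_gt _) _.
  by rewrite ler_nat.
- exact: ig.
- apply: aeW => x n _; rewrite /f_ /= lee_fin ger0_norm ?mulr_ge0 ?indicE//.
  by rewrite ler_piMr// lern1 leq_b1.
rewrite integral0 => /fine_cvgP[[N1 _ h1]].
move=> /cvgr0_norm_le/(_ _ d0)[N2 _ h2]; exists (maxn N1 N2).
have := h1 (maxn N1 N2) (leq_maxl _ _); have := h2 (maxn N1 N2) (leq_maxr _ _).
rewrite /= => le1 fin1; rewrite /mean -(fineK fin1) lee_fin; exact: le_trans (ler_norm _) le1.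
Qed.

Lemma cvg_measure0 (A : (set T)^nat) (delta : R) : (forall n, measurable (A n)) ->
  (forall n, A n.+1 `<=` A n) -> P (\bigcap_n A n) = 0%E -> 0 < delta ->
  exists n0, forall n, (n0 <= n)%N -> (P (A n) <= delta%:E)%E.
Proof.
move=> mA nA A0 d0.
have : P \o A @ \oo --> P (\bigcap_n A n).
  apply: nonincreasing_cvg_mu => //.
  - exact: le_lt_trans (probability_le1 P (mA 0%N)) (ltry _).
  - exact: bigcapT_measurable.
  - by apply/nonincreasing_seqP => n; exact/subsetPset.
rewrite A0 => /fine_cvgP[_ /cvgr0_norm_le/(_ _ d0)[N _ h]].
exists N => n /h /= hn; rewrite -(fineK (fin_num_measure P (A n) (mA n))) lee_fin.
exact: le_trans (ler_norm _) hn.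
Qed.

End expectation.

Lemma archimedean_le0 (R : realType) (a C : R) (n0 : nat) :
  (forall n, (n0 <= n)%N -> a * n%:R <= C) -> a <= 0.
Proof.
move=> h; rewrite leNgt; apply/negP => a0.
pose n := maxn n0 (Num.truncn (C / a)).+1.
have := h n (leq_maxl _ _); rewrite leNgt => /negP; apply.
rewrite -ltr_pdivrMl// mulrC; apply: lt_le_trans (truncnS_gt _) _.
by rewrite ler_nat leq_maxr.
Qed.

Lemma le_forall_scale (R : realType) (x C : R) : 0 <= C ->
  (forall delta, 0 < delta -> x <= C * delta) -> x <= 0.
Proof.
move=> C0 h; apply/ler_addgt0Pr => delta d0; rewrite add0r.
(* Dividing by C + 1 covers the case C = 0. *)
have C1 : 0 < C + 1 by rewrite ltr_wpDl.
apply: (le_trans (h (delta / (C + 1)) _)); first by rewrite divr_gt0.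
rewrite mulrA ler_pdivrMr// mulrC ler_wpM2l ?ltW//.
by rewrite ltrDl.
Qed.

(** * Covers of small weight and growth *)

Lemma sum_last (n l : nat) : (\sum_(0 <= j < n) (n <= j + l) = minn n l)%N.
Proof.
elim: n => [|n ih]; first by rewrite big_geq// min0n.
rewrite big_nat_recl//; under eq_bigr do rewrite addSn ltnS.
by rewrite ih; case: leqP; lia.
Qed.

Section stationarity.
Context (R : realType) (d : nat) (L : topologicalType) (F : affineFamily R d L)
  (P : probability (borelCodeTree F) R).
Hypothesis invP : invariant_measure P.
Implicit Types (w : borelCodeTree F) (f : borelCodeTree F -> R).

Lemma measurable_preimage_Xin n (B : set (borelCodeTree F)) : measurable B ->
  measurable (Xin n @^-1` B : set (borelCodeTree F)).
Proof.
by move=> mB; rewrite -[X in measurable X]setTI; exact: (measurable_Xin n).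
Qed.

Lemma invariant_Xin n (B : set (borelCodeTree F)) : measurable B ->
  P (Xin n @^-1` B) = P B.
Proof.
move=> mB; elim: n => [|n ih]; first by [].
rewrite -ih -(invP (measurable_preimage_Xin n mB)); congr (P _).
by apply/seteqP; split => w; rewrite /preimage/= -[Xi (Xin n w)]/(Xin n.+1 w) XinS.
Qed.

Lemma nnm_Xin n f : nnm f -> nnm (fun w => f (Xin n w)).
Proof.
move=> [mf f0]; split=> [|w]; last exact: f0.
exact: (measurableT_comp mf (measurable_Xin n)).
Qed.

Lemma mean_Xin n f : nnm f -> mean P (fun w => f (Xin n w)) = mean P f.
Proof.
move=> [mf f0]; rewrite /mean.
have := @ge0_integral_pushforward _ _ (borelCodeTree F) (borelCodeTree F) R (Xin n)
  (measurable_Xin n) P setT (EFin \o f) measurableT.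
rewrite preimage_setT => /= <-.
- apply: eq_measure_integral; first exact: measurable_Xin.
  by move=> mX A mA _; rewrite -[RHS](invariant_Xin n mA).
- exact/measurable_EFinP.
- by move=> w _; rewrite lee_fin.
Qed.

End stationarity.

(** * Mean growth on the set of null covers *)

Section null_covers_bound.
Context (R : realType) (d : nat) (L : topologicalType) (F : affineFamily R d L)
  (P : probability (borelCodeTree F) R).
Hypothesis invP : invariant_measure P.
Hypothesis neck_integrable : (mean P (fun w : borelCodeTree F => (level w 1)%:R) < +oo)%E.
Implicit Types (w : borelCodeTree F).

Lemma nnm_level n : nnm ((fun w => (level w n)%:R) : borelCodeTree F -> R).
Proof.
split=> //; apply: locally_determined_measurable.
by move=> w; have [m h] := locally_determined_level n w; exists m => w' /h ->.
Qed.

Lemma level_sum_Xin w n : level w n = (\sum_(i < n) level (Xin i w) 1)%N.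
Proof.
elim: n => [|n ih]; first by rewrite big_ord0.
by rewrite -[in LHS]addn1 level_split ih [RHS]big_ord_recr.
Qed.

Lemma mean_level_lt_pinfty n : (mean P (fun w => (level w n)%:R) < +oo)%E.
Proof.
have -> : (fun w => (level w n)%:R : R) =
    (fun w => \sum_(i <- index_enum 'I_n) (level (Xin i w) 1)%:R).
  by apply/funext => w; rewrite level_sum_Xin natr_sum.
rewrite mean_sum; last by move=> i; exact: (nnm_Xin i (nnm_level 1)).
apply: lte_sum_pinfty => i _; by rewrite (mean_Xin invP i (nnm_level 1)).
Qed.

Variables (s : R) (psi : nat -> codeTree F -> seq 'I_(maxmaps F) -> R) (k : nat).
Hypothesis wpsi : weight s psi.
Hypothesis wt_at_most1 : forall w u, isSome (tree w u) -> wt s w u <= 1.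

Let K := k.+1.
Let Z : set (borelCodeTree F) := [set w | null_covers psi (subtree k w)].
(** Every tree in [Z] has a cover of weight less than 1, so these sets decrease to the empty set as
    l grows. *)
Let B l : set (borelCodeTree F) := [set w | Z w /\ ~ covered psi (subtree k w) l 1].

Lemma covered_leq w l l' eps : (l <= l')%N -> covered psi w l eps -> covered psi w l' eps.
Proof.
(* Cutting [J] off at level l makes the additional levels contribute nothing. *)
move=> ll' [J Jc Js]; exists (fun u => J u && (size u <= level w l)%N).
  move=> u su wu; have [||m ml Jm] := Jc (take (level w l) u).
  - by rewrite size_takel// su level_le.
  - by apply: (@tree_prefix _ _ _ _ _ _ (drop (level w l) u)); rewrite cat_take_drop.
  have lm := level_le w ml; rewrite take_takel// in Jm.
  exists m; first exact: leq_trans ml ll'.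
  by rewrite Jm size_takel// su (leq_trans lm)// level_le.
congr (_ < _): Js; rewrite /cover_sum.
rewrite -(big_mkord xpredT (fun m =>
  \sum_(u <- words _ (level w m) | isSome (tree w u) && J u) psi m w u)).
rewrite -(big_mkord xpredT (fun m => \sum_(u <- words _ (level w m) |
  isSome (tree w u) && (J u && (size u <= level w l)%N)) psi m w u)).
rewrite [RHS](big_cat_nat (n := l.+1))//=; rewrite [X in _ + X]big_nat_cond [X in _ + X]big1 ?addr0.
  apply: eq_big_nat => m /andP[_ ml]; rewrite big_seq_cond [RHS]big_seq_cond.
  apply: eq_bigl => u; rewrite mem_words; case: eqP => //= ->.
  by rewrite level_le// andbT.
move=> m; rewrite andbT => /andP[lm _]; rewrite big_seq_cond big1// => u.
by rewrite mem_words => /and3P[/eqP -> _ /andP[_]]; rewrite leqNgt level_ltn.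
Qed.

Lemma measurable_Z : measurable Z.
Proof. exact: measurable_null_covers wpsi. Qed.

Lemma measurable_B l : measurable (B l).
Proof.
have -> : B l = Z `\` [set w | covered psi (subtree k w) l 1] by [].
apply: measurableD; first exact: measurable_Z.
exact: (finite_data_measurable (finite_data_covered (k := k) (l := l) (eps := 1) wpsi)).
Qed.

Lemma null_covers_Xin n (w : codeTree F) : null_covers psi w -> null_covers psi (Xin n w).
Proof.
by elim: n w => // n ih w Zw; rewrite XinS; exact: ih (null_covers_Xi wpsi Zw).
Qed.

Lemma Z_Xin n w : Z w -> Z (Xin (K * n) w).
Proof. by move=> Zw; have := null_covers_Xin n Zw; rewrite Xin_subtree. Qed.

(** As [Z] is forward invariant, a block without a short cover starts in [B l]. Its length is at
    most [kappa], or else is counted in the tail; the last l blocks form the second sum. *)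
Lemma bad_length_le w l n (kappa : nat) : Z w ->
  (bad_length psi l n (subtree k w))%:R <=
  \sum_(0 <= j < n) (kappa%:R * \1_(B l) (Xin (K * j) w) +
     (level (Xin (K * j) w) K)%:R *
       \1_[set y : borelCodeTree F | kappa%:R < (level y K)%:R :> R] (Xin (K * j) w)) +
  \sum_(0 <= j < n) (n <= j + l)%:R * (level (Xin (K * j) w) K)%:R :> R.
Proof.
move=> Zw; rewrite /bad_length natr_sum -big_split; apply: ler_sum => j _.
rewrite Xin_subtree natrM natrD level_subtree muln1 -/K.
set x := Xin _ w; rewrite mulrDl lerD2r.
have Zx : Z x by exact: Z_Xin.
have -> : (~~ `[< covered psi (subtree k x) l 1 >])%:R = \1_(B l) x :> R.
  rewrite indicE; congr (nat_of_bool _)%:R; apply/negP/idP => [nc|].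
    by apply/mem_set; split => // c; apply: nc; exact/asboolP.
  by move=> /set_mem[_ nc] /asboolP.
set b : R := \1_(B l) x; have b0 : 0 <= b by rewrite /b indicE.
have b1 : b <= 1 by rewrite /b indicE; case: (_ \in _).
have [kx|xk] := ltP kappa%:R ((level x K)%:R : R).
  rewrite [X in _ + _ * X]indicE mem_set//= mulr1 ler_wpDl ?mulr_ge0//.
  by rewrite ler_piMl.
rewrite [X in _ + _ * X]indicE memNset ?mulr0 ?addr0; last first.
  by rewrite /= ltNge xk.
by rewrite mulrC ler_wpM2r.
Qed.

(** Integrate the assumed growth over [Z]. By stationarity the mean of the bad length is at most 2 n
    [delta] plus a constant, so dividing by n, letting n grow and then [delta] tend to 0 leaves only
    the error [eta] of the growth bound. *)
Lemma null_covers_mean_bound (c eta : R) (H : nat -> borelCodeTree F -> R) (n0 : nat) :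
  0 <= c -> (forall n, nnm (H n)) ->
  (forall n w, Z w -> c * n%:R <= Num.max 0 (ln (level_sum psi n (subtree k w))) + H n w) ->
  (forall n, (n0 <= n)%N -> (mean P (H n) <= (n%:R * eta)%:E)%E) ->
  c * fine (P Z) <= eta.
Proof.
move=> c0 nH hH mH; rewrite -subr_le0.
set lnM : R := ln (maxmaps F)%:R.
have M1 : 1 <= (maxmaps F)%:R :> R by rewrite ler1n maxmaps_gt0.
have lnM0 : 0 <= lnM by exact: ln_ge0.
apply: (@le_forall_scale _ _ (lnM * 2)); first by rewrite mulr_ge0.
move=> delta d0.
(* The order of choice matters: first [kappa] makes the tail of the block length small in mean, then
   l makes [kappa] times the measure of [B l] small. *)
have [kappa tk] := mean_tail (nnm_level K) (mean_level_lt_pinfty K) d0.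
set tl : borelCodeTree F -> R := fun w => _ in tk.
have ntl : nnm tl.
  apply: nnm_mul; first exact: nnm_level.
  apply: nnm_indic; apply: finite_data_measurable.
  have -> : [set y : codeTree F | kappa%:R < (level y K)%:R :> R] =
     (fun w => level w K) @^-1` [set q | kappa%:R < q%:R :> R] by [].
  by apply: locally_determined_preimage; exact: locally_determined_level.
have [l Bl] : exists l, (P (B l) <= (delta / kappa.+1%:R)%:E)%E.
  have [|||n1 h] := @cvg_measure0 _ _ _ P B (delta / kappa.+1%:R) measurable_B.
  - move=> l w [Zw nc]; split => // cl; apply: nc; exact: covered_leq cl.
  - rewrite (_ : \bigcap_n B n = set0) ?measure0//; apply/seteqP; split => // w Bw.
    have [Zw _] := Bw 0%N I; have [l cl] := Zw 1 ltr01.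
    by have [_ /(_ cl)] := Bw l I.
  - by rewrite divr_gt0.
  - by exists n1; exact: h.
pose G : R := fine (mean P (fun w => (level w K)%:R)).
have GE : mean P (fun w => (level w K)%:R) = G%:E.
  rewrite /G fineK// ge0_fin_numE ?mean_level_lt_pinfty//.
  exact: mean_ge0 (nnm_level K).
pose p := fine (P Z).
have PE : P Z = p%:E by rewrite /p fineK// fin_num_measure//; exact: measurable_Z.
(* The last l blocks contribute a mean independent of n, which disappears as n tends to infinity. *)
rewrite -/p -subr_le0; apply: (@archimedean_le0 _ _ (lnM * (l%:R * G)) n0) => n nn0.
pose S1 : borelCodeTree F -> R := fun w => \sum_(0 <= j < n)
  (kappa%:R * \1_(B l) (Xin (K * j) w) + tl (Xin (K * j) w)).
pose S2 : borelCodeTree F -> R := fun w => \sum_(0 <= j < n)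
  (n <= j + l)%:R * (level (Xin (K * j) w) K)%:R.
have nB : nnm (\1_(B l) : borelCodeTree F -> R) := nnm_indic R (measurable_B l).
have nBX m : nnm (fun w : borelCodeTree F => \1_(B l) (Xin m w) : R).
  exact: (@nnm_Xin _ _ _ _ m (\1_(B l)) nB).
have n1 j : nnm (fun w : borelCodeTree F => kappa%:R * \1_(B l) (Xin (K * j) w) + tl (Xin (K * j) w)).
  apply: nnm_add; last exact: (nnm_Xin _ ntl).
  by apply: nnm_scale => //; exact: nBX.
have n2 j : nnm (fun w : borelCodeTree F => (n <= j + l)%:R * (level (Xin (K * j) w) K)%:R : R).
  by apply: nnm_scale => //; exact: (nnm_Xin _ (nnm_level K)).
have nS1 : nnm S1 by exact: nnm_sum.
have nS2 : nnm S2 by exact: nnm_sum.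
have mS1 : (mean P S1 <= (n%:R * (delta + delta))%:E)%E.
  rewrite /S1 mean_sum// (@le_trans _ _ (\sum_(0 <= j < n) (delta + delta)%:E)%E)//; last first.
    by rewrite sumEFin sumr_const_nat subn0 mulr_natl.
  apply: lee_sum => j _; rewrite mean_add; last 2 first.
  - by apply: nnm_scale => //; exact: nBX.
  - exact: (nnm_Xin _ ntl).
  rewrite EFinD leeD//; last by rewrite (mean_Xin invP _ ntl).
  rewrite (@mean_scale _ _ _ P kappa%:R _ (ler0n _ _) (nBX (K * j)%N)).
  rewrite (@mean_Xin _ _ _ _ _ invP _ (\1_(B l)) nB) (mean_indic _ (measurable_B l)).
  apply: (le_trans (lee_wpmul2l _ Bl)); first by rewrite lee_fin.
  rewrite -EFinM lee_fin mulrCA; apply: ler_piMr; first exact: ltW.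
  by rewrite ler_pdivrMr// mul1r ler_nat.
have mS2 : (mean P S2 <= (l%:R * G)%:E)%E.
  rewrite /S2 mean_sum// (eq_bigr (fun j => ((n <= j + l)%:R * G)%:E)); last first.
    move=> j _; rewrite mean_scale//; last exact: (nnm_Xin _ (nnm_level K)).
    by rewrite (mean_Xin invP _ (nnm_level K)) GE EFinM.
  rewrite sumEFin lee_fin -mulr_suml ler_wpM2r//.
    by rewrite -lee_fin -GE; exact: mean_ge0 (nnm_level K).
  by rewrite -natr_sum sum_last ler_nat geq_minr.
(* The growth is assumed on [Z] only, hence the indicator; elsewhere the right side is
   nonnegative. *)
have : (mean P (fun w : borelCodeTree F => (c * n%:R) * \1_Z w)%R <=
    mean P (fun w : borelCodeTree F => H n w + lnM * (S1 w + S2 w))%R)%E.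
  apply: mean_le.
  - by apply: nnm_scale; [rewrite mulr_ge0|exact: (nnm_indic R measurable_Z)].
  - by apply: nnm_add => //; apply: nnm_scale => //; exact: nnm_add.
  - have p0 w : 0 <= H n w + lnM * (S1 w + S2 w).
      by rewrite addr_ge0 ?mulr_ge0 ?addr_ge0//; [have [_] := nH n|have [_] := nS1|have [_] := nS2].
    move=> w; rewrite indicE; have [/set_mem Zw|_] := boolP (w \in Z); last by rewrite mulr0.
    rewrite mulr1; apply: (le_trans (hH n w Zw)); rewrite addrC lerD2l.
    rewrite ge_max mulr_ge0 ?addr_ge0//=; [|by have [_] := nS1|by have [_] := nS2].
    have := level_sum_le wpsi wt_at_most1 l n (subtree k w).
    rewrite -ler_ln ?posrE ?exprn_gt0 ?(level_sum_gt0 wpsi) ?(lt_le_trans ltr01)// => /le_trans; apply.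
    rewrite lnXn ?(lt_le_trans ltr01)// -[leLHS]mulr_natr ler_wpM2l//.
    exact: (bad_length_le l n kappa Zw).
rewrite mean_scale ?mulr_ge0//; last exact: (nnm_indic R measurable_Z).
rewrite (mean_indic _ measurable_Z) PE mean_add//; last first.
  by apply: nnm_scale => //; exact: nnm_add.
rewrite mean_scale//; last exact: nnm_add.
rewrite mean_add// => h.
have : ((c * n%:R)%:E * p%:E <= ((n%:R * eta) + lnM * (n%:R * (delta + delta) + l%:R * G))%:E)%E.
  apply: (le_trans h); rewrite EFinD leeD ?mH// EFinM lee_wpmul2l ?lee_fin//.
  by rewrite EFinD leeD.
rewrite -EFinM lee_fin; lra.
Qed.

End null_covers_bound.

(** * Pressure *)

Lemma sublinear_gaps_subtree (R : realType) (d : nat) (L : topologicalType)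
  (F : affineFamily R d L) k (w : codeTree F) : sublinear_gaps w -> sublinear_gaps (subtree k w).
Proof.
(* One factor k + 1 counts the gaps in a block, the other the rescaling of the index, and the factor
   2 turns m + 1 into at most 2 m for m at least 1. *)
move=> gw p; have [m0 h] := gw (2 * (k.+1 * k.+1) * p)%N.
exists (maxn 1 m0) => m; rewrite geq_max => /andP[m1 m0m].
rewrite Xin_subtree level_subtree muln1 level_sum_Xin.
have b (i : 'I_k.+1) : (level (Xin i (Xin (k.+1 * m) w)) 1 * (2 * (k.+1 * k.+1) * p) <= k.+1 * m + i)%N.
  rewrite -XinD; apply: h; apply: (leq_trans m0m).
  by rewrite mulSn -!addnA leq_addr.
have : ((\sum_(i < k.+1) level (Xin i (Xin (k.+1 * m) w)) 1) * (2 * (k.+1 * k.+1) * p)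
   <= \sum_(i < k.+1) (k.+1 * m.+1))%N.
  rewrite big_distrl; apply: leq_sum => i _; apply: (leq_trans (b i)).
  by rewrite mulnS addnC leq_add2r ltnW.
rewrite sum_nat_const card_ord.
move: (\sum_(i < k.+1) _)%N => S.
have -> : (S * (2 * (k.+1 * k.+1) * p) = (k.+1 * k.+1) * (2 * (S * p)))%N by ring.
by rewrite [X in (_ <= X)%N]mulnA leq_pmul2l// => h2; lia.
Qed.

Section pressure.
Context (R : realType) (d : nat) (L : topologicalType) (F : affineFamily R d L).
Hypothesis d_gt0 : (0 < d)%N.
Variables lo hi : R.
Hypotheses (lo_gt0 : 0 < lo) (hi_gt0 : 0 < hi) (hi_lt1 : hi < 1).
Hypothesis bounds : forall l (i : 'I_(nmaps (F l))) j, (j < d)%N ->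
  lo <= sigma (linear_part i) j <= hi.
Implicit Types (w : codeTree F) (s : R).

Lemma length_sum_gt0 s w n : 0 <= s -> 0 < length_sum s w n.
Proof.
move=> s0; have [u [su wu]] := tree_word w n.
rewrite /length_sum big_mkcond (bigD1_seq u)/= ?words_uniq ?mem_words ?su//.
rewrite wu ltr_wpDr ?wt_gt0//.
by apply: sumr_ge0 => v _; case: ifP => // wv; rewrite ltW// wt_gt0.
Qed.

Lemma length_sum_decr s s' w n : 0 <= s' -> s' <= s ->
  ln (length_sum s w n) <= ln (length_sum s' w n) - n%:R * ((s - s') * - ln hi).
Proof.
move=> s'0 s's; have s0 := le_trans s'0 s's.
have q0 : 0 < hi `^ (s - s') by rewrite powR_gt0.
have -> : ln (length_sum s' w n) - n%:R * ((s - s') * - ln hi) =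
    ln ((hi `^ (s - s')) ^+ n * length_sum s' w n).
  rewrite lnM ?posrE ?exprn_gt0 ?length_sum_gt0// lnXn// ln_powR.
  by rewrite mulrN mulrN opprK addrC mulr_natl.
rewrite ler_ln ?posrE ?mulr_gt0 ?exprn_gt0 ?length_sum_gt0//.
rewrite /length_sum mulr_sumr big_seq_cond [leRHS]big_seq_cond; apply: ler_sum => u.
rewrite mem_words => /andP[/eqP <- wu].
exact: (wt_decr d_gt0 hi_gt0 bounds wu s'0 s's).
Qed.

Lemma has_pressure_ln_bound w s (delta : R) : 0 <= s -> has_pressure w s 0 -> 0 < delta ->
  exists n0, forall n, (n0 <= n)%N -> `|ln (length_sum s w n)| <= n%:R * delta.
Proof.
move=> s0 /cvgr0_norm_le/[apply] -[N _ h]; exists (maxn 1 N) => n.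
rewrite geq_max => /andP[n0 Nn]; have := h n Nn; rewrite /= /pressure_seq.
rewrite (@sum_tuple_words _ _ n (fun u => isSome (tree w u)) (fun u => Phi s (word_map (tree w) u))).
rewrite normrM ger0_norm ?invr_ge0// ler_pdivrMl// ltr0n//.
Qed.

(** Half of the exponential rate separating the two exponents; the other half absorbs the
    subexponential error at the zero of the pressure. *)
Definition rate s s' : R := (s - s') * - ln hi / 2.

Lemma rate_gt0 s s' : s' < s -> 0 < rate s s'.
Proof.
move=> s's; rewrite /rate divr_gt0// mulr_gt0 ?subr_gt0// oppr_gt0 ln_lt0//.
by rewrite hi_gt0.
Qed.

Lemma pressure_lower w s0 s : 0 <= s -> s < s0 -> has_pressure w s0 0 ->
  exists n0, forall n, (n0 <= n)%N -> rate s0 s * n%:R <= ln (length_sum s w n).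
Proof.
move=> s_ge0 ss0 hp; have r0 := rate_gt0 ss0.
have [n0 h] := has_pressure_ln_bound (le_trans s_ge0 (ltW ss0)) hp r0.
exists n0 => n /h; rewrite ler_norml => /andP[h1 _].
have := length_sum_decr w n s_ge0 (ltW ss0); move: h1; rewrite /rate; lra.
Qed.

Lemma pressure_upper w s0 s (eps : R) j : 0 <= s0 -> s0 < s -> has_pressure w s0 0 -> 0 < eps ->
  exists2 n, (j <= n)%N & length_sum s w n <= eps.
Proof.
move=> s0_ge0 s0s hp e0; have r0 := rate_gt0 s0s.
have s_ge0 := le_trans s0_ge0 (ltW s0s).
have [n0 h] := has_pressure_ln_bound s0_ge0 hp r0.
pose n := maxn (maxn j n0) (Num.truncn (`|ln eps| / rate s s0)).+1.
exists n; first by rewrite /n -maxnA leq_maxl.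
rewrite -ler_ln ?posrE ?length_sum_gt0//.
have nn0 : (n0 <= n)%N by rewrite /n maxnAC leq_maxr.
have le1 : `|ln eps| <= rate s s0 * n%:R.
  rewrite -ler_pdivrMl// mulrC; apply: ltW; apply: lt_le_trans (truncnS_gt _) _.
  by rewrite ler_nat leq_maxr.
have := h n nn0; rewrite ler_norml => /andP[_ h2].
have := length_sum_decr w n s0_ge0 (ltW s0s).
have : - ln eps <= `|ln eps| by rewrite -normrN ler_norm.
move: h2 le1; rewrite /rate; lra.
Qed.

(** All words of length n in the tree form a cover of the boundary. *)
Lemma affinity_measure0 w s : 0 <= s ->
  (forall (eps : R) j, 0 < eps -> exists2 n, (j <= n)%N & length_sum s w n <= eps) ->
  affinity_measure w s (boundary w) = 0%E.
Proof.
move=> s0 h; have p0 j : affinity_premeasure w s j (boundary w) = 0%E.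
  apply/eqP; rewrite eq_le; apply/andP; split; last first.
    apply: le_ereal_inf_tmp => _ [J [Jw _ _] <-]; apply: esum_ge0 => u Ju.
    by rewrite lee_fin ltW// wt_gt0// Jw.
  apply/lee_addgt0Pr => eps e0; rewrite add0e; have [n jn hn] := h eps j e0.
  apply: (@le_trans _ _ (length_sum s w n)%:E); last by rewrite lee_fin.
  pose J := [set u | size u = n /\ isSome (tree w u)].
  apply: ge_ereal_inf; exists (\esum_(u in J) (wt s w u)%:E)%E.
    exists J => //; split.
    - by move=> u [].
    - by move=> x bx; exists (mkseq x n); rewrite /J /word_cylinder/= size_mkseq.
    - by move=> u [->].
  pose r := [seq u <- words 'I_(maxmaps F) n | isSome (tree w u)].
  have JE : J = [set` r].
    apply/seteqP; split => u /=; rewrite mem_filter mem_words.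
      by move=> [-> ->]; rewrite eqxx.
    by case/andP => wu /eqP su.
  rewrite JE esum_fset; [|exact: finite_seq|]; last first.
    move=> u /set_mem; rewrite /= mem_filter => /andP[wu _].
    by rewrite lee_fin ltW// wt_gt0.
  by rewrite -fsbig_seq ?filter_uniq ?words_uniq// sumEFin lee_fin big_filter.
rewrite /affinity_measure; have -> : affinity_premeasure w s ^~ (boundary w) = cst 0%E.
  by apply/funext => j; exact: p0.
exact: lim_cst.
Qed.

Lemma affinity_dimension_le w s0 : 0 <= s0 -> has_pressure w s0 0 ->
  (affinity_dimension w <= s0%:E)%E.
Proof.
move=> s00 hp; apply/lee_addgt0Pr => eps e0; apply: ereal_inf_lbound.
exists (s0 + eps) => //; split; first by rewrite addr_ge0// ltW.
apply: affinity_measure0; first by rewrite addr_ge0// ltW.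
by move=> eps' j e'0; apply: pressure_upper hp e'0; rewrite // ltrDl.
Qed.

End pressure.

(** * Almost every code tree *)

Section almost_everywhere.
Context (R : realType) (d : nat) (L : topologicalType) (F : affineFamily R d L)
  (P : probability (borelCodeTree F) R).
Hypothesis d_gt0 : (0 < d)%N.
Hypothesis invP : invariant_measure P.
Hypothesis neck_integrable :
  (mean P (fun w : borelCodeTree F => (level w 1)%:R) < +oo)%E.
Variables lo hi : R.
Hypotheses (lo_gt0 : 0 < lo) (lo_lt1 : lo < 1) (hi_gt0 : 0 < hi) (hi_lt1 : hi < 1).
Hypothesis bounds : forall l (i : 'I_(nmaps (F l))) j, (j < d)%N ->
  lo <= sigma (linear_part i) j <= hi.
Implicit Types (w : borelCodeTree F) (s : R).

Let wtle1 s w u : 0 <= s -> isSome (tree w u) -> wt s w u <= 1.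
Proof. by move=> s0 wu; exact: (wt_le1 d_gt0 hi_gt0 hi_lt1 bounds wu s0). Qed.

(** Borel-Cantelli for each p: by stationarity the probabilities that p times the m-th gap exceeds m
    add up to at most p times the mean of N_1. *)
Lemma ae_sublinear_gaps : {ae P, forall w, sublinear_gaps w}.
Proof.
apply: ae_foralln => p.
pose A m : set (borelCodeTree F) := Xin m @^-1` [set w | (m < level w 1 * p)%N].
have mA0 m : measurable ([set w | (m < level w 1 * p)%N] : set (borelCodeTree F)).
  apply: (@finite_data_measurable _ _ _ _ ((fun w => level w 1) @^-1` [set q | (m < q * p)%N])).
  by apply: locally_determined_preimage; exact: locally_determined_level.
have mA m : measurable (A m) by exact: measurable_preimage_Xin.
exists (lim_sup_set A); split.
- by apply: bigcapT_measurable => n; apply: bigcup_measurable => j _; exact: mA.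
- apply: lim_sup_set_cvg0 => //.
  apply: (@le_lt_trans _ _ (p%:R%:E * mean P (fun w : borelCodeTree F => (level w 1)%:R)))%E; last first.
    by rewrite lte_mul_pinfty// lee_fin.
  apply: lime_le; first by apply: is_cvg_nneseries => n _ _; exact: measure_ge0.
  apply: nearW => n.
  rewrite -mean_scale//; last exact: nnm_level.
  rewrite (eq_bigr (fun m => mean P
    (\1_[set w | (m < level w 1 * p)%N] : borelCodeTree F -> R))); last first.
    by move=> m _; rewrite mean_indic// -(invariant_Xin invP m (mA0 m)).
  rewrite -mean_sum; last by move=> m; exact: nnm_indic.
  apply: mean_le.
  + by apply: nnm_sum => m; exact: nnm_indic.
  + by apply: nnm_scale => //; exact: nnm_level.
  + move=> w; rewrite -natrM mulnC; under eq_bigr do rewrite indicE.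
    rewrite -natr_sum ler_nat.
    have E i : (w \in [set w | (i < level w 1 * p)%N]) = (i < level w 1 * p)%N.
      by apply/idP/idP => [/set_mem|/mem_set].
    under eq_bigr do rewrite E.
    (* At most q indices i are less than q. *)
    elim: n (level w 1 * p)%N => [|n ih] q; first by rewrite big_geq.
    case: q => [|q]; first by rewrite big1.
    rewrite big_nat_recl//=; under eq_bigr do rewrite ltnS.
    by rewrite add1n ltnS.
- move=> w /= nw n _; apply: contrapT => h; apply: nw; exists n => m nm.
  by rewrite leqNgt; apply/negP => mm; apply: h; exists m.
Qed.

Section fixed_exponent.
Variables (s0 s : R).
Hypotheses (s_ge0 : 0 <= s) (s_lt : s < s0).
Hypothesis s0_zero : {ae P, forall w, has_pressure w s0 0}.

Let c := rate hi s0 s.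

Let c_gt0 : 0 < c.
Proof. exact: rate_gt0. Qed.

Let E n : set (borelCodeTree F) :=
  [set w | c * (level w n)%:R <= ln (length_sum s w (level w n))].

Let measurableE n : measurable (~` E n).
Proof.
apply: (@finite_data_measurable _ _ _ _ ((fun w => (level w n, length_sum s w (level w n))) @^-1`
  [set q | ~ (c * q.1%:R <= ln q.2)])).
apply: locally_determined_preimage; apply: locally_determined_pair.
  exact: locally_determined_level.
exact: locally_determined_length_sum.
Qed.

(** Almost surely [E n] holds for all large n, since N_n is at least n and the pressure at s is
    positive; continuity from above turns this into smallness of measure. *)
Lemma growth_measure (delta : R) : 0 < delta ->
  exists n0, forall n, (n0 <= n)%N -> (P (~` E n) <= delta%:E)%E.
Proof.
move=> d0; pose A n := \bigcup_m ~` E (n + m).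
have mA n : measurable (A n) by apply: bigcupT_measurable => m; exact: measurableE.
have [|||n0 h] := @cvg_measure0 _ _ _ P A delta mA.
- by move=> n w [m _ h]; exists m.+1; rewrite // addnS -addSn.
- apply: measure_negligible; first exact: bigcapT_measurable.
  apply: negligibleS s0_zero => w Aw hp.
  have [n0 h] := pressure_lower d_gt0 hi_gt0 hi_lt1 bounds s_ge0 s_lt hp.
  have [m _] := Aw n0 I; apply; apply: h.
  by rewrite (leq_trans (leq_addr m n0))// leq_level.
- by [].
exists n0 => n /h; apply: le_trans; apply: le_measure.
- by apply: mem_set; exact: measurableE.
- by apply: mem_set; exact: mA.
- by move=> w h'; exists 0%N; rewrite // addn0.
Qed.

(** Every neck is kept and the level sum is the pressure sum at N_n, which grows at rate c on [E n].
    Off [E n] the whole of c n is treated as error. *)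
Lemma null_covers_wt_measure0 : s < d%:R ->
  P [set w | null_covers (fun _ w u => wt s w u) (subtree 0 w)] = 0%E.
Proof.
move=> sd; have wp := wt_weight F d_gt0 s_ge0 sd.
pose Z : set (borelCodeTree F) :=
  [set w | null_covers (fun _ w u => wt s w u) (subtree 0 w)].
have mZ : measurable Z by exact: measurable_null_covers wp.
rewrite -(fineK (fin_num_measure P Z mZ)); congr EFin; apply/eqP.
rewrite eq_le fine_ge0// andbT -(pmulr_rle0 _ c_gt0).
apply: (@le_forall_scale _ _ c (ltW c_gt0)) => delta d0.
have [n0 hn0] := growth_measure d0.
apply: (@null_covers_mean_bound _ _ _ _ _ invP neck_integrable s _ 0 wp _ c (c * delta)
  (fun n w => (c * n%:R) * \1_(~` E n) w) n0).
- by move=> w u; exact: wtle1.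
- exact: ltW.
- move=> n; apply: nnm_scale; first by rewrite mulr_ge0// ltW.
  exact: nnm_indic.
- move=> n w _; have -> : level_sum (fun _ w u => wt s w u) n (subtree 0 w) =
      length_sum s w (level w n) by rewrite /level_sum level_subtree mul1n.
  rewrite indicE; have [_|/negP nE] := boolP (w \in ~` E n).
    by rewrite mulr1 lerDr le_max lexx.
  have Ew : E n w by apply: contrapT => h; apply: nE; exact/mem_set.
  rewrite mulr0 addr0 le_max; apply/orP; right; apply: le_trans Ew.
  by rewrite ler_wpM2l ?ler_nat ?leq_level// ltW.
- move=> n /hn0 h; have nE : nnm (\1_(~` E n) : borelCodeTree F -> R) by exact: nnm_indic.
  rewrite (mean_scale P (mulr_ge0 (ltW c_gt0) (ler0n R n)) nE) mean_indic//.
  apply: (le_trans (lee_wpmul2l _ h)); first by rewrite lee_fin mulr_ge0// ltW.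
  by rewrite -EFinM lee_fin [c * n%:R]mulrC mulrA.
Qed.

Lemma length_sum_lower w n : d%:R <= s ->
  - (s * - ln lo) * n%:R <= ln (length_sum s w n).
Proof.
move=> ds; have [u [su wu]] := tree_word w n.
have -> : - (s * - ln lo) * n%:R = ln ((lo `^ s) ^+ n).
  by rewrite lnXn ?powR_gt0// ln_powR mulrN opprK mulr_natr.
rewrite ler_ln ?posrE ?exprn_gt0 ?powR_gt0 ?length_sum_gt0//.
apply: (@le_trans _ _ (wt s w u)); first by rewrite -su; exact: (wt_lower d_gt0 lo_gt0 bounds ds wu).
rewrite /length_sum big_mkcond (bigD1_seq u)/= ?words_uniq ?mem_words ?su//.
rewrite wu lerDl; apply: sumr_ge0 => v _; case: ifP => // wv.
by rewrite ltW// wt_gt0.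
Qed.

(** The logarithm of the level sum is a sum over blocks of K necks. A block starting in [E K]
    contributes at least c K, any other at least -C times its length, so the mean loss per block is
    at most K (c + 2 C) [delta]; the factor K cancels. *)
Lemma null_covers_block_measure0 : d%:R <= s ->
  P (\bigcap_k [set w | null_covers (block_wt s) (subtree k w)]) = 0%E.
Proof.
move=> ds; have wp := block_weight F d_gt0 ds.
have lower := length_sum_lower _ _ ds.
have : 0 <= s * - ln lo by rewrite mulr_ge0// oppr_ge0 ltW// ln_lt0// lo_gt0.
move: (s * - ln lo) lower => C lower C0.
pose Z k : set (borelCodeTree F) := [set w | null_covers (block_wt s) (subtree k w)].
have mZ k : measurable (Z k) by exact: measurable_null_covers wp.
have mI : measurable (\bigcap_k Z k) by exact: bigcapT_measurable.
rewrite -(fineK (fin_num_measure P _ mI)); congr EFin; apply/eqP.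
rewrite eq_le fine_ge0// andbT -(pmulr_rle0 _ c_gt0).
apply: (@le_forall_scale _ _ (c + C + C)).
  by rewrite !addr_ge0// ltW.
move=> delta d0.
have [kappa tk] := mean_tail (nnm_level F 1) neck_integrable d0.
set tl : borelCodeTree F -> R := fun w => _ in tk.
have ntl : nnm tl.
  apply: nnm_mul; first exact: nnm_level.
  apply: nnm_indic.
  apply: (@finite_data_measurable _ _ _ _ ((fun w => level w 1) @^-1` [set q | kappa%:R < q%:R :> R])).
  by apply: locally_determined_preimage; exact: locally_determined_level.
(* The bad event is small even after multiplication by [kappa]. The block length depends on [delta],
   which is why the intersection over all k is estimated. *)
have [k hk] := growth_measure (divr_gt0 d0 (ltr0Sn R kappa)).
have {hk}hk : (P (~` E k.+1) <= (delta / kappa.+1%:R)%:E)%E by apply: hk; exact: leqnSn.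
set K := k.+1 in hk.
apply: (@le_trans _ _ (c * fine (P (Z k)))).
  rewrite ler_wpM2l ?(ltW c_gt0)// fine_le ?fin_num_measure//.
  by apply: le_measure; [exact: mem_set|exact: mem_set|move=> w; exact].
have K0 : 0 < K%:R :> R by rewrite ltr0n.
rewrite -(ler_pM2l K0) mulrA.
(* The loss in one block: off [E K] the missing c K, plus C times the block length, each gap being
   bounded by [kappa] or counted in the tail. *)
pose h : borelCodeTree F -> R := fun w =>
  (c * K%:R + C * (K%:R * kappa%:R)) * \1_(~` E K) w + C * \sum_(0 <= i < K) tl (Xin i w).
have ck0 : 0 <= c * K%:R + C * (K%:R * kappa%:R).
  apply: addr_ge0; first by rewrite mulr_ge0// ltW.
  by apply: mulr_ge0 => //; exact: mulr_ge0.
have nE : nnm (\1_(~` E K) : borelCodeTree F -> R) by exact: nnm_indic.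
have nS : nnm (fun w : borelCodeTree F => \sum_(0 <= i < K) tl (Xin i w)).
  by apply: nnm_sum => i; exact: (nnm_Xin i ntl).
have nh : nnm h by apply: nnm_add; exact: nnm_scale.
have mh : (mean P h <= (K%:R * ((c + C + C) * delta))%:E)%E.
  rewrite mean_add; [|exact: nnm_scale|exact: nnm_scale].
  rewrite (mean_scale P ck0 nE) (mean_scale P C0 nS) mean_indic//.
  rewrite mean_sum; last by move=> i; exact: (nnm_Xin i ntl).
  apply: (@le_trans _ _ (((c * K%:R + C * (K%:R * kappa%:R)) * (delta / kappa.+1%:R))%:E +
     (C * (K%:R * delta))%:E)%E).
    apply: leeD; first by rewrite EFinM; apply: lee_wpmul2l; rewrite ?lee_fin.
    rewrite EFinM; apply: lee_wpmul2l; first by rewrite lee_fin.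
    apply: (@le_trans _ _ (\sum_(0 <= i < K) delta%:E)%E).
      by apply: lee_sum => i _; rewrite (mean_Xin invP i ntl).
    by rewrite sumEFin sumr_const_nat subn0 mulr_natl.
  rewrite -EFinD lee_fin.
  have b1 : delta / kappa.+1%:R <= delta.
    by rewrite ler_pdivrMr//; apply: ler_peMr; [exact: ltW|rewrite ler1n].
  have b2 : kappa%:R * (delta / kappa.+1%:R) <= delta.
    rewrite mulrCA; apply: ler_piMr; first exact: ltW.
    by rewrite ler_pdivrMr// mul1r ler_nat.
  have := ler_wpM2l (ltW K0) (lerD (ler_wpM2l (ltW c_gt0) b1) (ler_wpM2l C0 b2)).
  move: (delta / kappa.+1%:R) (K%:R) (kappa%:R) c => D r q c'.
  lra.
apply: (@null_covers_mean_bound _ _ _ _ _ invP neck_integrable s _ k wp _ (K%:R * c)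
  (K%:R * ((c + C + C) * delta)) (fun n w => \sum_(0 <= j < n) h (Xin (K * j) w)) 0).
- by move=> w u; exact: wtle1.
- by rewrite mulr_ge0// ltW.
- by move=> n; apply: nnm_sum => j; exact: (nnm_Xin _ nh).
- move=> n w _; apply: (@le_trans _ _ (ln (level_sum (block_wt s) n (subtree k w)) +
    \sum_(0 <= j < n) h (Xin (K * j) w))); last by rewrite lerD2r le_max lexx orbT.
  have -> : ln (level_sum (block_wt s) n (subtree k w)) =
      \sum_(0 <= j < n) ln (length_sum s (Xin (K * j) w) (level (Xin (K * j) w) K)).
    rewrite level_sum_block.
    have e j : length_sum s (Xin j (subtree k w)) (level (Xin j (subtree k w)) 1) =
        length_sum s (Xin (K * j) w) (level (Xin (K * j) w) K).
      by rewrite Xin_subtree level_subtree muln1.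
    elim: n => [|n ih]; first by rewrite big_ord0 big_geq// ln1.
    rewrite big_ord_recr big_nat_recr//= lnM ?posrE; last 2 first.
    + by apply: prodr_gt0 => j _; exact: length_sum_gt0.
    + exact: length_sum_gt0.
    by rewrite ih e.
  rewrite -big_split mulr_natr -[X in _ *+ X]subn0 -sumr_const_nat.
  apply: ler_sum => j _ /=; set x := Xin _ w; rewrite /h.
  have S0 : 0 <= C * \sum_(0 <= i < K) tl (Xin i x) by rewrite mulr_ge0//; have [_] := nS.
  rewrite indicE; have [_|/negP nEx] := boolP (x \in ~` E K).
    rewrite mulr1; have lw := lower x (level x K).
    suff : C * (level x K)%:R <= C * (K%:R * kappa%:R) + C * \sum_(0 <= i < K) tl (Xin i x).
      by move: lw; lra.
    rewrite -mulrDr ler_wpM2l// level_sum_Xin natr_sum.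
    rewrite -(big_mkord xpredT (fun i => (level (Xin i x) 1)%:R)).
    have -> : K%:R * kappa%:R = \sum_(0 <= i < K) kappa%:R :> R.
      by rewrite sumr_const_nat subn0 mulr_natl.
    rewrite -big_split; apply: ler_sum => i _ /=; rewrite /tl indicE.
    have [h1|h1] := ltP (kappa%:R : R) (level (Xin i x) 1)%:R.
      by rewrite mem_set//= mulr1 lerDr.
    by rewrite memNset ?mulr0 ?addr0//= ltNge h1.
  have Ex : E K x by apply: contrapT => h'; apply: nEx; exact/mem_set.
  rewrite mulr0 add0r; apply: ler_wpDr => //; apply: le_trans Ex.
  by rewrite mulrC ler_wpM2l ?ler_nat ?leq_level// ltW.
- move=> n _; rewrite mean_sum; last by move=> j; exact: (nnm_Xin _ nh).
  apply: (@le_trans _ _ (\sum_(0 <= j < n) (K%:R * ((c + C + C) * delta))%:E)%E).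
    by apply: lee_sum => j _; rewrite (mean_Xin invP _ nh).
  by rewrite sumEFin sumr_const_nat subn0 lee_fin -[leLHS]mulr_natl.
Qed.

(** The affinity measure depends on the tree and not on its necks. Were it zero at some s' < s,
    [null_covers_affinity] would apply to every thinned neck list and place the tree in a null
    set. *)
Lemma ae_affinity_measure_neq0 : {ae P, forall w, forall s', 0 <= s' -> s' < s ->
  affinity_measure w s' (boundary w) <> 0%E}.
Proof.
have ng := ae_sublinear_gaps.
have [ds|sd] := leP d%:R s.
- have wp := block_weight F d_gt0 ds.
  have mZ : measurable (\bigcap_k [set w : borelCodeTree F | null_covers (block_wt s) (subtree k w)]).
    by apply: bigcapT_measurable => k; exact: measurable_null_covers wp.
  have nZ : P.-negligible (\bigcap_k [set w : borelCodeTree F | null_covers (block_wt s) (subtree k w)]).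
    by exists (\bigcap_k [set w | null_covers (block_wt s) (subtree k w)]); split => //;
      exact: null_covers_block_measure0.
  apply: negligibleS (negligibleU nZ ng) => w nw.
  have [gw|] := pselect (sublinear_gaps w); last by right.
  left => k _; apply: contrapT => nk; apply: nw => s' s'0 s's aff; apply: nk.
  exact: (@null_covers_affinity _ _ _ _ d_gt0 _ _ hi_gt0 hi_lt1 bounds _ _ _ (subtree k w)
    wp s'0 s's (sublinear_gaps_subtree k gw) aff).
- have wp := wt_weight F d_gt0 s_ge0 sd.
  have nZ : P.-negligible [set w : borelCodeTree F | null_covers (fun _ w u => wt s w u) (subtree 0 w)].
    exists [set w | null_covers (fun _ w u => wt s w u) (subtree 0 w)]; split => //.
      exact: measurable_null_covers wp.
    exact: null_covers_wt_measure0.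
  apply: negligibleS (negligibleU nZ ng) => w nw.
  have [gw|] := pselect (sublinear_gaps w); last by right.
  left; apply: contrapT => nk; apply: nw => s' s'0 s's aff; apply: nk.
  exact: (@null_covers_affinity _ _ _ _ d_gt0 _ _ hi_gt0 hi_lt1 bounds _ _ _ (subtree 0 w)
    wp s'0 s's (sublinear_gaps_subtree 0 gw) aff).
Qed.

End fixed_exponent.

End almost_everywhere.

Theorem mainTheorem2 (R : realType) (d : nat) (d_gt0 : (0 < d)%N)
    (L : topologicalType) (F : affineFamily R d L)
    (P : probability (borelCodeTree F) R)
    (P_invariant : invariant_measure P)
    (P_ergodic : ergodic_measure P)
    (neck_integrable : (\int[P]_w ((neck w 0)%:R%:E) < +oo)%E)
    (s0 : R) (s0_ge0 : 0 <= s0)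
    (s0_zero : {ae P, forall w, has_pressure w s0 0}) :
  {ae P, forall w, affinity_dimension w = s0%:E}.
Proof.
have [lo [hi [lo_gt0 lo_lt1 hi_gt0 hi_lt1 bounds]]] := sigma_bounded F.
(* Countably many exponents increasing to s0 give a single exceptional null set; for s0 = 0 the
   claim is empty. *)
have positive : {ae P, forall w, forall n s', 0 <= s' -> s' < s0 * (1 - n.+1%:R^-1) ->
    affinity_measure w s' (boundary w) <> 0%E}.
  apply: ae_foralln => n.
  have n1 : n.+1%:R^-1 <= 1 :> R by rewrite invf_le1 ?ler1n.
  have [->|s0_neq0] := eqVneq s0 0.
    by apply: aeW => w s' s'0; rewrite mul0r ltNge s'0.
  have s0_gt0 : 0 < s0 by rewrite lt_neqAle eq_sym s0_neq0.
  apply: (ae_affinity_measure_neq0 d_gt0 P_invariant neck_integrable lo_gt0 lo_lt1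
    hi_gt0 hi_lt1 bounds _ _ s0_zero).
    by rewrite mulr_ge0// subr_ge0.
  by rewrite gtr_pMr// gtrBl invr_gt0.
apply: negligibleS (negligibleU s0_zero positive) => w nw.
have [pressure0|] := pselect (has_pressure w s0 0); last by left.
right => pos; apply: nw; apply/eqP; rewrite eq_le.
rewrite (affinity_dimension_le d_gt0 hi_gt0 hi_lt1 bounds s0_ge0 pressure0)/=.
apply: le_ereal_inf_tmp => _ [s [s_ge0 aff0] <-]; rewrite lee_fin leNgt.
apply/negP => s_lt.
have s0_gt0 : 0 < s0 := le_lt_trans s_ge0 s_lt.
(* This n satisfies s0 / (s0 - s) < n + 1, that is, s < s0 (1 - 1/(n+1)). *)
pose n := Num.truncn (s0 / (s0 - s)).
apply: (pos n s s_ge0 _ aff0).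
have : s0 / (s0 - s) < n.+1%:R by exact: truncnS_gt.
rewrite ltr_pdivrMr ?subr_gt0// => h.
rewrite mulrBr mulr1 ltrBrDl -ltrBrDr ltr_pdivrMr ?ltr0n//.
by rewrite mulrC.
Qed.
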